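(* For $D\ge 3$, the Min-Facet Component Algorithm (described in full in the context) provides a $\frac{2}{D}$-factor approximation for the Max Morse Matching Problem on $D$-dimensional simplicial manifolds without boundary. That is, on every such manifold $\mathcal{K}$ the Morse matching it outputs has at least $\frac{2}{D}\cdot\mathrm{OPT}(\mathcal{K})$ regular simplices.
   Context: For simplices $\tau,\sigma$ of a (finite) simplicial complex $\mathcal{K}$ write $\tau\prec\sigma$ ($\tau$ is a facet of $\sigma$, $\sigma$ a cofacet of $\tau$) if $\tau\subset\sigma$ and $\dim\tau=\dim\sigma-1$. The Hasse graph $H$ of $\mathcal{K}$ is the undirected graph whose vertices are the simplices of $\mathcal{K}$, with an edge between $\tau$ and $\sigma$ exactly when $\tau\prec\sigma$. The $d$-interface is the subgraph on the $d$-simplices and $(d-1)$-simplices with all edges between them. In an orientation, an edge $\tau\to\sigma$ with $\tau\prec\sigma$ is an up-edge and $\sigma\to\tau$ is a down-edge. The orientation induced by a matching $M$ makes the edges of $M$ up-edges and all others down-edges. $M$ is a Morse (acyclic) matching if this directed graph has no directed cycle. Simplices covered by $M$ are regular. The Max Morse Matching Problem asks for a Morse matching with the maximum number of regular simplices; this maximum is $\mathrm{OPT}(\mathcal{K})$. Frontier procedure on a subgraph $W$ of an interface. Compute a maximum-cardinality matching of $W$ and let $\overline{W}$ be the induced orientation. An up-edge from $\alpha$ to $\beta$ is written $\chi(\alpha,\beta)$. A leading up-edge of $\chi_1(\alpha_1,\beta_1)$ is an up-edge $\chi_3(\alpha_2,\beta_2)$ such that $\beta_1\to\alpha_2$ is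 a down-edge. The facet-edges of $\beta$ are the edges between $\beta$ and its facets, with current orientations. While $\overline{W}$ contains an up-edge $\chi$, compute an edge set $C$ as follows, then move $C$ from $\overline{W}$ to the output. Start with $C=\emptyset$ and queue $\{\chi\}$. While the queue is nonempty, dequeue $\chi_0(\alpha_0,\beta_0)$ and add the facet-edges of $\beta_0$ to $C$; for every leading up-edge $\chi_i(\alpha_i,\beta_i)$ of $\chi_0$, if $C$ together with the facet-edges of $\beta_i$ has a cycle, reverse $\chi_i$ and add the facet-edges of $\beta_i$ to $C$, otherwise enqueue $\chi_i$. Finally add the remaining edges to the output. The up-edges of the output are the resulting matching. Procedure intermediateApx$(W,d)$. (1) Apply the frontier procedure to $W$. (2) For every unmatched $(d-1)$-simplex $\tau$ of $W$ all of whose cofacets in $W$ are also unmatched, match $\tau$ with one of these cofacets. (3) Make the matched pairs up-edges in the output orientation, and delete from the Hasse graph all simplices matched in this step and all critical (unmatched) $(d-1)$-simplices of $W$. Procedure DFSoptimal on a connected graph: choose an arbitrary start vertex, leave it critical, run a depth-first search, and whenever an unvisited vertex $w$ is reached from $v$ along an edge, match $w$ with that edge. Min-Facet Component Algorithm. Start with all edges of the output orientation being down-edges. Process the interfaces in the order $d=1,\dots,D$, each time extracting the $d$-interface $G^d$ of the current Hasse graph (after all deletions so far). - $d=1$: apply DFSoptimal to the graph whose vertices and edges are the $0$- and $1$-simplices; record the matched pairs as up-edges and delete from the Hasse graph the matched simplices and the critical $0$-simplices. - $1<d<D$: while some $d$-simplex has at least one facet remaining in $G^d$, extract a min-facet component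 $F$ and apply intermediateApx$(F,d)$ (the deletions apply also to $G^d$). Here the facet degree of a $d$-simplex is its number of facets in the current $G^d$; a min-facet simplex is one whose facet degree is minimum among the $d$-simplices with at least one facet; a min-facet component is a maximal connected subgraph of $G^d$ induced by a set of min-facet simplices. - $d=D$: apply DFSoptimal to the dual graph of the current $D$-interface (vertices are the $D$-simplices; edges are the remaining $(D-1)$-simplices, each joining the two $D$-simplices that have it as a common facet), and record the matched pairs as up-edges. The up-edges of the final orientation are the output Morse matching. *)

(* Defs.v *)
From HB Require Import structures.
From mathcomp Require Import all_boot all_order all_algebra.

Set Implicit Arguments.
Unset Strict Implicit.
Unset Printing Implicit Defensive.

Section Complexes.
Variable V : finType.

Notation simplex := {set V}.
(* An edge of the Hasse graph is stored as the pair (facet, cofacet). *)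
Notation edge := ({set V} * {set V})%type.

Implicit Types (K H W F G N A S : {set simplex}) (E C M U : {set edge}).
Implicit Types (visited : {set simplex}) (p : seq simplex) (r : seq edge).
Implicit Types (s t v w a : simplex) (e x : edge) (d D : nat).

(* Simplices are nonempty, so that 0-simplices have no facets. *)
Definition simplicial_complex K : bool :=
  (set0 \notin K) &&
  [forall s in K, forall t : simplex, (t \subset s) && (t != set0) ==> (t \in K)].

Definition has_dimension K D : bool := \max_(s in K) #|s| == D.+1.

Definition link K s : {set simplex} :=
  [set t in K | [disjoint t & s] && (t :|: s \in K)].

Definition facet t s : bool := (t \subset s) && (#|s| == #|t|.+1).

Definition simplices H d : {set simplex} := [set s in H | #|s| == d.+1].

(* All subgraphs below are induced: they are given by their set of nodes. *)
Definition edges W : {set edge} :=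
  [set e : edge | [&& e.1 \in W, e.2 \in W & facet e.1 e.2]].

Definition interface H d : {set simplex} := simplices H d :|: simplices H d.-1.

Definition endpoints e : {set simplex} := [set e.1; e.2].

Definition matching E M : bool :=
  (M \subset E) &&
  [forall e in M, forall x in M, (e != x) ==> [disjoint endpoints e & endpoints x]].

Definition regular M : {set simplex} := \bigcup_(e in M) endpoints e.

(* An orientation is given by its set U of up-edges: the edges of E that lie in
   U point from facet to cofacet, the other ones from cofacet to facet. *)
Definition arc E U : rel simplex :=
  [rel s t | ((s, t) \in E :&: U) || ((t, s) \in E :\: U)].

Definition has_dicycle E U : bool :=
  [exists s, exists t, arc E U s t && connect (arc E U) t s].

Definition morse_matching K M : bool :=
  matching (edges K) M && ~~ has_dicycle (edges K) M.

Definition OPT K : nat := \max_(M | morse_matching K M) #|regular M|.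

Definition maximum_matching E M : Prop :=
  matching E M /\ forall M', matching E M' -> #|M'| <= #|M|.

(* The edges still in the oriented subgraph of the frontier procedure form a
   shrinking set E. Moving a set C of edges to the output removes it from E. No
   edge is reoriented after it has been moved, so a single set U records the
   up-edges of both E and the output. *)

Definition facet_edges E s : {set edge} := [set e in E | e.2 == s].

Definition leading_up_edges E U x : {set edge} :=
  [set y in E :&: U | (y.1, x.2) \in E :\: U].

(* State: the collected set C, the up-edges U, and the queue. *)
Definition frontier_check E (st : {set edge} * {set edge} * seq edge) y :=
  let: (C, U, q) := st in
  let C' := C :|: facet_edges E y.2 in
  if has_dicycle C' U then (C', U :\ y, q) else (C, U, rcons q y).

(* [frontier_queue E C U q C' U']: processing the queue q until it is empty
   leads from (C, U) to (C', U'). The leading up-edges of the dequeued edge are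
   examined in an arbitrary order r. *)
Inductive frontier_queue E :
  {set edge} -> {set edge} -> seq edge -> {set edge} -> {set edge} -> Prop :=
| frontier_queue_empty C U : frontier_queue E C U [::] C U
| frontier_dequeue C U x q r C1 U1 q1 C' U' of
    perm_eq r (enum (leading_up_edges E U x)) &
    foldl (frontier_check E) (C :|: facet_edges E x.2, U, q) r = (C1, U1, q1) &
    frontier_queue E C1 U1 q1 C' U' :
    frontier_queue E C U (x :: q) C' U'.

Inductive frontier_loop : {set edge} -> {set edge} -> {set edge} -> Prop :=
| frontier_loop_stop E U of E :&: U = set0 : frontier_loop E U U
| frontier_loop_step E U x C U1 U' of
    x \in E :&: U &
    frontier_queue E set0 U [:: x] C U1 &
    frontier_loop (E :\: C) U1 U' :
    frontier_loop E U U'.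

Definition frontier W M : Prop :=
  exists2 M0, maximum_matching (edges W) M0 & frontier_loop (edges W) M0 M.

Definition cofacets W t : {set simplex} := [set s in W | facet t s].

(* t can be matched with its cofacet s in the second step *)
Definition extendable W d M t s : bool :=
  [&& t \in simplices W d.-1, t \notin regular M,
      cofacets W t :&: regular M == set0 & s \in cofacets W t].

(* The simplices are handled one after the other: matching one of them can
   disqualify others, but never qualifies a new one. *)
Inductive extension W d : {set edge} -> {set edge} -> Prop :=
| extension_stop M of (forall t s, ~~ extendable W d M t s) : extension W d M M
| extension_step M t s M' of
    extendable W d M t s & extension W d ((t, s) |: M) M' :
    extension W d M M'.

Definition intermediate_apx W d M : Prop :=
  exists2 M0, frontier W M0 & extension W d M0 M.

(* What remains of the Hasse graph H after the matching M has been recorded and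
   the matched simplices and the critical (d-1)-simplices of W are deleted *)
Definition delete_from H W d M : {set simplex} :=
  H :\: (regular M :|: (simplices W d.-1 :\: regular M)).

Definition facet_degree G s : nat := #|[set t in G | facet t s]|.

Definition min_facet_simplices G d : {set simplex} :=
  [set s in simplices G d | (0 < facet_degree G s) &&
    [forall s' in simplices G d,
       (0 < facet_degree G s') ==> (facet_degree G s <= facet_degree G s')]].

Definition facet_hull G S : {set simplex} :=
  S :|: [set t in G | [exists s in S, facet t s]].

Definition connected_subgraph W : bool :=
  (W != set0) &&
  [forall s in W, forall t in W,
     connect [rel u v | [&& u \in W, v \in W & facet u v || facet v u]] s t].

(* The subgraph induced by a set S of d-simplices comprises their facets in G. *)
Definition min_facet_component G d F : Prop :=
  exists2 S : {set simplex},
    maxset (fun S' : {set simplex} => (S' \subset min_facet_simplices G d) &&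
                                      connected_subgraph (facet_hull G S')) S &
    F = facet_hull G S.

(* The nodes form the set N, the graph edges the set A, and [inc v a] says that
   the node v is an end of the graph edge a. *)
Definition joins (inc : rel simplex) a v w : bool :=
  [&& v != w, inc v a & inc w a].

Definition advances (inc : rel simplex) N A (visited : {set simplex}) v w a : bool :=
  [&& w \in N :\: visited, a \in A & joins inc a v w].

(* State: the visited nodes, the stack of the search, and the pairs (node, graph
   edge) matched so far. A search is started at an arbitrary node, which is
   left critical; on a connected graph this happens once, and otherwise once
   per connected component. *)
Inductive dfs_run (inc : rel simplex) N A :
  {set simplex} -> seq simplex -> {set edge} -> {set edge} -> Prop :=
| dfs_stop visited M of N \subset visited : dfs_run inc N A visited [::] M M
| dfs_start visited v M M' of
    v \in N :\: visited & dfs_run inc N A (v |: visited) [:: v] M M' :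
    dfs_run inc N A visited [::] M M'
| dfs_advance visited v p w a M M' of
    advances inc N A visited v w a &
    dfs_run inc N A (w |: visited) [:: w, v & p] ((w, a) |: M) M' :
    dfs_run inc N A visited (v :: p) M M'
| dfs_backtrack visited v p M M' of
    (forall w a, ~~ advances inc N A visited v w a) &
    dfs_run inc N A visited p M M' :
    dfs_run inc N A visited (v :: p) M M'.

Definition dfs_optimal (inc : rel simplex) N A M : Prop :=
  dfs_run inc N A set0 [::] set0 M.

(* In the relations below H is the current Hasse graph and U the set of up-edges
   of the output orientation. All choices are left open; the relations hold
   between the input and every possible result of a complete run. *)

Definition first_interface H M : Prop :=
  dfs_optimal facet (simplices H 0) (simplices H 1) M.

Inductive middle_interface d :
  {set simplex} -> {set edge} -> {set simplex} -> {set edge} -> Prop :=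
| middle_stop H U of
    (forall s, s \in simplices H d -> facet_degree (interface H d) s = 0) :
    middle_interface d H U H U
| middle_step H U F M H' U' of
    min_facet_component (interface H d) d F &
    intermediate_apx F d M &
    middle_interface d (delete_from H F d M) (U :|: M) H' U' :
    middle_interface d H U H' U'.

(* [middle_interfaces D d]: the interfaces d, d + 1, ..., D - 1 in turn *)
Inductive middle_interfaces D : nat ->
  {set simplex} -> {set edge} -> {set simplex} -> {set edge} -> Prop :=
| middle_interfaces_stop H U : middle_interfaces D D H U H U
| middle_interfaces_step d H U H1 U1 H' U' of
    d < D &
    middle_interface d H U H1 U1 &
    middle_interfaces D d.+1 H1 U1 H' U' :
    middle_interfaces D d H U H' U'.

(* Here the nodes of the dual graph are cofacets, so the pairs are flipped. *)
Definition last_interface H D M : Prop :=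
  exists2 P, dfs_optimal [rel s t | facet t s] (simplices H D) (simplices H D.-1) P &
             M = [set (x.2, x.1) | x in P].

Definition min_facet_output K D M : Prop :=
  exists M1 H U MD,
    [/\ first_interface K M1,
        middle_interfaces D 2 (delete_from K K 1 M1) M1 H U,
        last_interface H D MD &
        M = U :|: MD].

(* Barycentric coordinates are rows indexed by the enumeration of the vertices. *)
Definition carrier (R : nmodType) (x : 'rV[R]_#|V|) : simplex :=
  [set v : V | x ord0 (enum_rank v) != 0%R].

End Complexes.

From mathcomp Require Import boolp classical_sets functions reals topology normedtype.
Import Order.TTheory GRing.Theory Num.Theory.
Import numFieldNormedType.Exports.

Local Open Scope classical_set_scope.
Local Open Scope ring_scope.

Definition realization (R : realType) (V : finType) (L : {set {set V}}) :
    set 'rV[R]_#|V| :=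
  [set x : 'rV[R]_#|V| | [/\ forall i, 0 <= x ord0 i, \sum_i x ord0 i = 1 & carrier x \in L]].

(* The unit sphere of R^n, of dimension n - 1; it is empty for n = 0. *)
Definition unit_sphere (R : realType) (n : nat) : set 'rV[R]_n :=
  [set x : 'rV[R]_n | \sum_i x ord0 i ^+ 2 = 1].

Definition homeomorphic (T U : topologicalType) (A : set T) (B : set U) : Prop :=
  exists (f : T -> U) (g : U -> T),
    [/\ set_fun A B f, set_fun B A g,
        {in A, cancel f g}, {in B, cancel g f} &
        {within A, continuous f} /\ {within B, continuous g}].

(* Every simplex s, of dimension #|s| - 1, has as its link a sphere of dimension
   D - #|s|. For #|s| = D + 1 both are empty, and for #|s| = D the link consists
   of two points. *)
Definition simplicial_manifold (R : realType) (V : finType)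
    (K : {set {set V}}) (D : nat) : Prop :=
  [/\ simplicial_complex K, has_dimension K D &
      forall s, s \in K ->
        homeomorphic (@realization R V (link K s)) (@unit_sphere R (D.+1 - #|s|))].

(* Main.v *)
(** In each interface an acyclic matching is controlled by its V-paths: write
    [lead M s t] when a facet of [s] is matched with [t <> s]. Every
    [(d-1)]-simplex of a min-facet component ends up in a matched [d]-simplex,
    and such a simplex has at most [d] facets left: if all [d+1] facets of all
    [d]-simplices survived, then, links being connected, a whole component of
    the manifold would have lost none of its [(d-1)]-simplices, whereas the
    facets of a single [d]-simplex cannot all be matched downwards
    acyclically. With [m d] pairs found and [p d] optimal pairs in the
    [d]-interface this gives [d * m d + m (d-1) >= n (d-1) >= p (d-1) + p d] for
    [1 < d < D], where [n i] counts the [i]-simplices. Removing the matched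
    [(D-1)]-simplices does not disconnect the dual graph, so both extreme
    interfaces are solved optimally, and [2 * n (D-1) = (D+1) * n D] together
    with the sum of these inequalities yields the ratio [2/D]. *)

Require Import Defs.
From mathcomp Require Import all_boot all_order all_algebra.
From mathcomp Require Import reals.
From mathcomp Require boolp classical_sets functions topology normedtype realfun.
From mathcomp Require Import ring lra zify.

Set Implicit Arguments.
Unset Strict Implicit.
Unset Printing Implicit Defensive.

(** * Connectedness of spheres *)

Section Sphere.
Import Order.TTheory GRing.Theory Num.Theory.
Import boolp classical_sets functions topology normedtype realfun.
Import numFieldNormedType.Exports.
Local Open Scope classical_set_scope.
Local Open Scope ring_scope.
Variable R : realType.

(** The ratio comes from the summed inequalities: every [p i] occurs in two of them, which gives the
    2, while [m i] is used [i] times in its own interface and once in the next, so at most [D] times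
    for [i < D]. The complex need not be connected. The dual search may then have several roots, and
    these critical [D]-simplices enter the balance through [n (D-1)]. The first interface pays for
    them: the roots are pairwise disjoint simplices, each with at least [D] matched vertices. That
    the dual graph stays connected on each component is a parity argument modulo 2 around simplices
    of codimension 2. Topology enters only through three facts on links: they are nonempty, consist
    of two points, or are connected, according to the dimension. The last one is derived from the
    intermediate value theorem on great arcs. Acyclicity is expressed throughout as the absence of a
    nonempty set in which every simplex has a predecessor. Such sets can be restricted, united and
    reversed without handling explicit cycles. *)

Definition sqnorm n (x : 'rV[R]_n) : R := \sum_i x ord0 i ^+ 2.

Lemma sqnorm_ge0 n (x : 'rV[R]_n) : 0 <= sqnorm x.
Proof. by apply: sumr_ge0 => i _; exact: sqr_ge0. Qed.

Lemma sqnorm_eq0 n (x : 'rV[R]_n) : sqnorm x = 0 -> x = 0.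
Proof.
move=> /eqP; rewrite psumr_eq0 => [/allP h|i _]; last exact: sqr_ge0.
apply/rowP => i; rewrite mxE; apply/eqP.
by move: (h i); rewrite mem_index_enum => /(_ isT); rewrite sqrf_eq0.
Qed.

Lemma sqnormZ n a (x : 'rV[R]_n) : sqnorm (a *: x) = a ^+ 2 * sqnorm x.
Proof. by rewrite mulr_sumr; apply: eq_bigr => i _; rewrite mxE exprMn. Qed.

Definition segment n (p q : 'rV[R]_n) (t : R) := (1 - t) *: p + t *: q.

(** Taking norms in [(1 - t) *: p = - (t *: q)] forces t = 1/2, and then p = -q. *)
Lemma segment_neq0 n (p q : 'rV[R]_n) t :
  sqnorm p = 1 -> sqnorm q = 1 -> p != - q -> sqnorm (segment p q t) != 0.
Proof.
move=> p1 q1 pq; apply/eqP => /sqnorm_eq0 /eqP; rewrite addr_eq0 => /eqP h.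
have := congr1 (@sqnorm n) h; rewrite -scaleNr !sqnormZ p1 q1 !mulr1 => e.
have t2 : t = 2^-1 by nra.
move: h; rewrite t2 -scalerN (_ : 1 - 2^-1 = 2^-1); last by lra.
move/(scalerI _) => /(_ _) e2; move/eqP: pq; apply.
by apply: e2; rewrite invr_eq0 pnatr_eq0.
Qed.

Definition arc_path n (p q : 'rV[R]_n) (t : R) :=
  (Num.sqrt (sqnorm (segment p q t)))^-1 *: segment p q t.

Lemma arc_path_on n (p q : 'rV[R]_n) t :
  sqnorm p = 1 -> sqnorm q = 1 -> p != - q -> sqnorm (arc_path p q t) = 1.
Proof.
move=> p1 q1 pq; rewrite sqnormZ exprVn sqr_sqrtr ?sqnorm_ge0 //.
by rewrite mulVf // segment_neq0.
Qed.

Lemma segment_continuous n (p q : 'rV[R]_n) : continuous (segment p q).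
Proof.
move=> t; apply: cvgD; apply: cvgZ; try exact: cvg_cst; last exact: cvg_id.
by apply: cvgB; [exact: cvg_cst | exact: cvg_id].
Qed.

Lemma sqnorm_continuous n : continuous (@sqnorm n).
Proof.
move=> x; apply: (@continuous_big _ _ +%R 0 xpredT); first by apply: add_continuous.
move=> i _ y; apply: (@continuous_comp _ _ _ (fun z : 'rV[R]_n => z ord0 i) (fun u =>
  u ^+ 2)).
  exact: coord_continuous.
exact: exprn_continuous.
Qed.

Lemma arc_path_continuous n (p q : 'rV[R]_n) :
  sqnorm p = 1 -> sqnorm q = 1 -> p != - q -> continuous (arc_path p q).
Proof.
move=> p1 q1 pq t; apply: cvgZ; last exact: segment_continuous.
apply: cvgV; first by rewrite sqrtr_eq0 -ltNge lt_def segment_neq0 ?sqnorm_ge0.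
apply: (@continuous_comp _ _ _ (fun t => sqnorm (segment p q t)) Num.sqrt);
  last exact: sqrt_continuous.
apply: (@continuous_comp _ _ _ (segment p q) (@sqnorm n)); last exact: sqnorm_continuous.
exact: segment_continuous.
Qed.

(** Two points that are not antipodal are joined by the radial projection of their segment, along
    which the intermediate value theorem forbids a jump from 0 to 1. The dimension [n.+2] leaves
    room for a detour between antipodal points. *)
Lemma sphere_continuous_const n (phi : 'rV[R]_n.+2 -> R) p q :
  {within @unit_sphere R n.+2, continuous phi} ->
  (forall x, @unit_sphere R n.+2 x -> phi x = 0 \/ phi x = 1) ->
  @unit_sphere R n.+2 p -> @unit_sphere R n.+2 q -> phi p = phi q.
Proof.
move=> /subspace_continuousP phic phi01.
have arcP p' q' : @unit_sphere R n.+2 p' -> @unit_sphere R n.+2 q' -> p' != - q' ->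
    phi p' = phi q'.
  move=> p1 q1 pq.
  have ac := arc_path_continuous p1 q1 pq.
  (* The arc is defined and stays on the sphere for every real t, so continuity of [phi] within the
     sphere gives continuity of the composite on the whole line. *)
  have cont : continuous (phi \o arc_path p' q').
    move=> t W /= hW; have := phic _ (arc_path_on t p1 q1 pq) W hW.
    rewrite /within /= => hn.
    have := ac t _ hn.
    rewrite !nbhs_simpl /=.
    apply: (@filterS _ (nbhs t) _) => u /=; apply.
    exact: arc_path_on.
  have e0 : arc_path p' q' 0 = p'.
    by rewrite /arc_path /segment subr0 !scale1r scale0r addr0 (p1 : sqnorm p' = 1)
      sqrtr1 invr1 scale1r.
  have e1 : arc_path p' q' 1 = q'.
    by rewrite /arc_path /segment subrr !scale1r scale0r add0r (q1 : sqnorm q' = 1)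
      sqrtr1 invr1 scale1r.
  have mid : ~ exists2 c, c \in `[(0:R), 1] & (phi \o arc_path p' q') c = 2^-1.
    move=> [c _ /=].
    by case: (phi01 (arc_path p' q' c) (arc_path_on c p1 q1 pq)) => ->; lra.
  have iv := IVT ler01 (continuous_subspaceT cont).
  suff : phi (arc_path p' q' 0) = phi (arc_path p' q' 1) by rewrite e0 e1.
  case: (phi01 (arc_path p' q' 0) (arc_path_on 0 p1 q1 pq)) => a0;
  case: (phi01 (arc_path p' q' 1) (arc_path_on 1 p1 q1 pq)) => a1; rewrite a0 a1 //;
  case: mid; apply: iv => /=; rewrite a0 a1 /Order.min /Order.max ?ltxx ?ltr01 ?ltr10; lra.
move=> p1 q1.
(* Antipodal points are compared through a third point: the last basis vector or, if that is p or
   -p, the first one. *)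
case: (eqVneq p (- q)) => [pq|]; last exact: arcP.
have delta1 (i : 'I_n.+2) : @unit_sphere R n.+2 (delta_mx 0 i).
  rewrite /unit_sphere /= (bigD1 i) //= mxE !eqxx expr1n big1 ?addr0 //.
  by move=> j ji; rewrite mxE (negbTE ji) andbF expr0n.
have del01 (c : R) : (delta_mx 0 ord0 : 'rV[R]_n.+2) != c *: delta_mx 0 ord_max.
  by apply/eqP => /rowP /(_ ord0); rewrite !mxE !eqxx /= mulr0 => /eqP; rewrite oner_eq0.
have [r [r1 rp rq]] : exists r, [/\ @unit_sphere R n.+2 r, p != - r & r != - q].
  have -> : q = - p by rewrite pq opprK.
  rewrite opprK.
  have [pd|pd] := boolP ((p == delta_mx 0 ord_max) || (p == - delta_mx 0 ord_max)).
    exists (delta_mx 0 ord0); split => //.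
      case/orP: pd => /eqP ->; last rewrite eqr_opp; rewrite -1?eqr_oppLR eq_sym.
        by rewrite -scaleN1r.
      by have := del01 1; rewrite scale1r.
    case/orP: pd => /eqP ->; first by have := del01 1; rewrite scale1r.
    by rewrite -scaleN1r.
  move: pd; rewrite negb_or => /andP[a b].
  by exists (delta_mx 0 ord_max); split => //; rewrite eq_sym.
by rewrite (arcP p r) // (arcP r q).
Qed.

End Sphere.

(** * Links in a simplicial manifold *)

Section Realization.
Import Order.TTheory GRing.Theory Num.Theory.
Import boolp classical_sets functions topology normedtype.
Import numFieldNormedType.Exports.
Import mathcomp.boot.finset.
Local Open Scope ring_scope.
Variables (R : realType) (V : finType).
Implicit Types (L K : {set {set V}}) (s t : {set V}) (u v w : V).

Definition vertex_point v : 'rV[R]_#|V| := delta_mx 0 (enum_rank v).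

Lemma carrier_vertex_point v : carrier (vertex_point v) = [set v]%SET.
Proof.
apply/setP => u; rewrite !inE mxE eqxx (inj_eq enum_rank_inj) /=.
by case: (u == v); rewrite ?oner_eq0 ?eqxx.
Qed.

Lemma sum_coord (x : 'rV[R]_#|V|) (P : pred V) :
  \sum_(v | P v) x ord0 (enum_rank v) = \sum_(v in carrier x | P v) x ord0 (enum_rank v).
Proof.
rewrite [LHS]big_mkcond [RHS]big_mkcond; apply: eq_bigr => v _.
rewrite inE; case: (P v); rewrite ?andbF // andbT.
by case: eqP => //= ->.
Qed.

Lemma sum_enum_rank (x : 'rV[R]_#|V|) : \sum_i x ord0 i = \sum_v x ord0 (enum_rank v).
Proof. by rewrite (reindex enum_rank) //=; apply: onW_bij; exact: enum_rank_bij. Qed.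

Lemma realization_vertex_point L v : [set v]%SET \in L -> realization L (vertex_point v).
Proof.
move=> vL; split; last by rewrite carrier_vertex_point.
  by move=> i; rewrite mxE eqxx /=; case: eqP => // _; exact: ler01.
rewrite sum_enum_rank sum_coord carrier_vertex_point.
by rewrite (eq_bigl [pred i | i == v]) ?big_pred1_eq ?mxE ?eqxx // => u; rewrite !inE andbT.
Qed.

Lemma carrier1_eq L x v : realization L x -> carrier x = [set v]%SET -> x = vertex_point v.
Proof.
move=> [_ x1 _] cx; apply/rowP => i; rewrite mxE eqxx /= -(enum_valK i).
rewrite (inj_eq enum_rank_inj); case: eqP => [->|/eqP ne].
  move: x1; rewrite sum_enum_rank sum_coord cx.
  by rewrite (eq_bigl [pred i | i == v]) ?big_pred1_eq // => u; rewrite !inE andbT.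
have : enum_val i \notin carrier x by rewrite cx inE.
by rewrite inE negbK => /eqP.
Qed.

End Realization.

Section Links.
Import Order.TTheory GRing.Theory Num.Theory.
Import boolp classical_sets functions topology normedtype.
Import numFieldNormedType.Exports.
Import mathcomp.boot.finset.
Local Open Scope ring_scope.
Variables (R : realType) (V : finType) (K : {set {set V}}) (D : nat).
Hypothesis manK : simplicial_manifold R K D.
Implicit Types (s t : {set V}) (u v w : V).

Lemma manifold_complex : simplicial_complex K. Proof. by case: manK. Qed.

Lemma simplex_sub s t : s \in K -> t \subset s -> t != set0 -> t \in K.
Proof.
move=> sK ts t0; case/andP: manifold_complex => _ /forallP /(_ s) /implyP /(_ sK).
by move=> /forallP /(_ t); rewrite ts t0.
Qed.

Lemma simplex_neq0 s : s \in K -> s != set0.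
Proof. by apply: contraTneq => ->; case/andP: manifold_complex. Qed.

Lemma simplex_card s : s \in K -> (#|s| <= D.+1)%N.
Proof. by case: manK => _ /eqP <- _ sK; exact: leq_bigmax_cond. Qed.

Lemma link_card s t : t \in link K s -> (#|t| + #|s| <= D.+1)%N.
Proof.
rewrite inE => /and3P[_ dis tsK]; rewrite -(_ : #|t :|: s| = #|t| + #|s|)%N.
  exact: simplex_card.
by apply/eqP; rewrite (leq_card_setU t s).2.
Qed.

Lemma link_sub s t t' : t \in link K s -> t' \subset t -> t' != set0 -> t' \in link K s.
Proof.
rewrite !inE => /and3P[tK dis tsK] sub t0.
apply/and3P; split; [exact: simplex_sub tK _ _ | exact: disjointWl sub dis |].
apply: (simplex_sub tsK); first exact: setSU.
by apply: contraNneq t0 => e; rewrite -subset0 -e subsetUl.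
Qed.

Lemma link_vertex s v : s \in K ->
  ([set v] \in link K s)%SET = (v \notin s) && (v |: s \in K).
Proof.
move=> sK; rewrite inE disjoints1.
case: (v \notin s); rewrite ?andbF //=; apply/andP/idP => [[]//|vsK].
split=> //; apply: (simplex_sub vsK); first exact: subsetUl.
by apply/set0Pn; exists v; rewrite inE.
Qed.

Lemma carrier_link s x : realization (R := R) (link K s) x -> carrier x \in link K s.
Proof. by case. Qed.

(** The sphere homeomorphic to the link has dimension at least 0, hence a point; any vertex in the
    carrier of the image of this point extends [s]. *)
Lemma manifold_pure s : s \in K -> (#|s| <= D)%N -> exists2 v, v \notin s & v |: s \in K.
Proof.
move=> sK sD; case: manK => _ _ /(_ s sK) [f [g [_ gL _ _ _]]].
have n0 : (0 < D.+1 - #|s|)%N by rewrite subn_gt0.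
pose x : 'rV[R]_(D.+1 - #|s|) := delta_mx 0 (Ordinal n0).
have x1 : unit_sphere x.
  rewrite /unit_sphere /= (bigD1 (Ordinal n0)) //= mxE !eqxx expr1n big1 ?addr0 //.
  by move=> j ji; rewrite mxE (negbTE ji) andbF expr0n.
have cL := carrier_link (gL _ x1).
have [v vc] : exists v, v \in carrier (g x).
  by apply/set0Pn/simplex_neq0; move: cL; rewrite inE => /andP[].
have : ([set v] \in link K s)%SET.
  by apply: (link_sub cL); rewrite ?sub1set //; apply/set0Pn; exists v; rewrite inE.
by rewrite link_vertex // => /andP[? ?]; exists v.
Qed.

Lemma link_singleton s x : (#|s| = D)%N -> realization (R := R) (link K s) x ->
  exists2 v, x = vertex_point R v & ([set v] \in link K s)%SET.
Proof.
move=> sD xL; have cL := carrier_link xL.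
have := link_card cL; rewrite sD => c1.
have : carrier x != set0 by apply: simplex_neq0; move: cL; rewrite inE => /andP[].
rewrite -card_gt0 => c0; have /cards1P [v cv] : #|carrier x| == 1 by lia.
by exists v; [exact: carrier1_eq xL cv | rewrite -cv].
Qed.

Lemma sphere0P (x : 'rV[R]_1) : unit_sphere x -> x = 1%:M \/ x = (-1)%:M.
Proof.
rewrite /unit_sphere /= big_ord1 => /eqP; rewrite sqrf_eq1 => /orP[]/eqP h; [left|right];
  by apply/rowP => i; rewrite mxE !ord1 h.
Qed.

(** Cofacets of [s] correspond to vertices of its link. By dimension every point of the link is a
    vertex, and the homeomorphism matches them with 1 and -1. *)
Lemma manifold_codim1 s : s \in K -> (#|s| = D)%N -> #|cofacets K s| = 2%N.
Proof.
move=> sK sD; case: manK => _ _ /(_ s sK).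
have -> : (D.+1 - #|s|)%N = 1%N by lia.
move=> [f [g [fS gL fK gK _]]].
pose A := [set v | ([set v] \in link K s)%SET]%SET.
have -> : cofacets K s = [set v |: s | v in A]%SET.
  apply/setP => t; apply/idP/imsetP.
    rewrite !inE => /andP[tK /andP[st /eqP ct]].
    have /cards1P [v tv] : #|t :\: s| == 1.
      by apply/eqP; move: (cardsID s t); rewrite (setIidPr st) ct; lia.
    have tE : t = v |: s by rewrite -tv setDE setUIl setUC [_ :|: s]setUC setUCr setIT;
      apply/esym/setUidPr.
    by exists v => //; rewrite inE link_vertex // -tE tK -[v \in s]negbK;
      have : v \in t :\: s by [rewrite tv inE]; rewrite inE => /andP[-> _].
  move=> [v]; rewrite inE link_vertex // => /andP[vs vK] ->.
  by rewrite !inE vK /facet subsetUr cardsU1 vs add1n eqxx.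
rewrite card_in_imset; last first.
  move=> u v; rewrite !inE => /and3P[_ us _] /and3P[_ vs _] e.
  have : u \in v |: s by rewrite -e !inE eqxx.
  rewrite disjoints1 in us.
  by rewrite !inE (negbTE us) orbF => /eqP.
have sp (e : R) : e ^+ 2 = 1 -> unit_sphere (e%:M : 'rV[R]_1).
  by move=> e1; rewrite /unit_sphere /= big_ord1 mxE eqxx.
have sp1 := sp 1 (expr1n _ _).
have /sp spN1 : (-1 : R) ^+ 2 = 1 by rewrite sqrrN expr1n.
have [a ga Aa] := link_singleton sD (gL _ sp1).
have [b gb Ab] := link_singleton sD (gL _ spN1).
have ab : a != b.
  apply/eqP => e; have : f (g 1%:M) = f (g (-1)%:M) by rewrite ga gb e.
  rewrite (gK _ (mem_set sp1)) (gK _ (mem_set spN1)) =>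
    /rowP /(_ ord0); rewrite !mxE !eqxx /= ?mulr1n =>
      h; have : (1 : R) = -1 by [exact: h]; lra.
rewrite (_ : A = [set a; b]%SET) ?cards2 ?ab //.
apply/setP => v; rewrite [v \in A]inE [RHS]inE !in_set1.
apply/idP/orP => [vL|[/eqP -> //|/eqP -> //]].
have vp := @realization_vertex_point R _ _ _ vL.
have inj u : vertex_point R v = vertex_point R u -> v == u.
  by move=> e; apply/eqP/set1_inj; rewrite -!(carrier_vertex_point R) e.
have fv := fK _ (mem_set vp).
by case: (sphere0P (fS _ vp)) => e; [left|right]; apply: inj; rewrite -fv e ?ga ?gb.
Qed.

(* The coordinates indexed by X sum to 1 or 0 at each point of the realization
   of the link, so they give a continuous function with values 0 and 1. *)
Lemma manifold_link_connected s (X : {set V}) v w : s \in K -> (#|s| < D)%N ->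
  (forall u u', u \in X -> u' \notin s -> u |: (u' |: s) \in K -> u' \in X) ->
  v \notin s -> v |: s \in K -> w \notin s -> w |: s \in K -> v \in X -> w \in X.
Proof.
move=> sK sD closX vs vK ws wK vX; case: manK => _ _ /(_ s sK).
have [n ->] : exists n, (D.+1 - #|s|)%N = n.+2 by exists (D - #|s|).-1; lia.
move=> [f [g [fS gL fK gK [_ gc]]]].
pose h (x : 'rV[R]_#|V|) : R := \sum_(i | enum_val i \in X) x ord0 i.
have hE x : h x = \sum_(u | u \in X) x ord0 (enum_rank u).
  rewrite /h (reindex (@enum_rank V)) /=.
    by apply: eq_bigl => u; rewrite enum_rankK.
  by apply: onW_bij; exact: enum_rank_bij.
(* As [X] is closed under adjacency in the link, a carrier that meets [X] lies inside it, and the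
   coordinates of [x] sum to 1. *)
have h01 x : realization (R := R) (link K s) x -> h x = if [disjoint carrier x & X] then
  0 else 1.
  move=> xL; have [_ x1 _] := xL.
  rewrite hE sum_coord; case: ifPn => [dis|].
    rewrite big1 // => u /andP[uc uX].
    by rewrite (disjointFr dis uc) in uX.
  case/pred0Pn => u /andP[/= uc uX].
  rewrite -x1 sum_enum_rank sum_coord; apply: eq_bigl => u'.
  rewrite andbT andb_idr // => u'c.
  have cL := carrier_link xL; move: cL; rewrite inE => /and3P[_ dis cK].
  apply: (closX u) => //.
    by rewrite (disjointFr dis u'c).
  apply: (simplex_sub cK).
    by rewrite setUA; apply: setSU; rewrite subUset !sub1set uc.
  by apply/set0Pn; exists u; rewrite !inE eqxx.
have Lv u : u \notin s -> u |: s \in K -> realization (R :=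
  R) (link K s) (vertex_point R u).
  by move=> us uK; apply: realization_vertex_point; rewrite link_vertex // us.
have hc : continuous h.
  move=> x; apply: (@continuous_big _ _ +%R 0 (fun i =>
    enum_val i \in X)); first by apply: add_continuous.
  by move=> i _ y; exact: coord_continuous.
have := @sphere_continuous_const R n (h \o g) (f (vertex_point R v)) (f (vertex_point R w)).
have gv := fK _ (mem_set (Lv v vs vK)); have gw := fK _ (mem_set (Lv w ws wK)).
rewrite /= gv gw !h01 ?carrier_vertex_point; try exact: Lv.
rewrite !disjoints1 vX /=; case: (w \in X) => // e.
have /eqP : (1 : R) = 0.
  apply: e; try by apply: fS; exact: Lv.
    by move=> x; apply: (@continuous_comp _ _ _ (from_subspace (@unit_sphere R n.+2) g) h
      x); [exact: gc | exact: hc].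
  by move=> x xS; rewrite /= h01; [case: ifP; [left|right] | exact: gL].
by rewrite oner_eq0.
Qed.

End Links.

(** * Cycles of a finite relation *)

Section Traps.
Variable T : finType.
Implicit Types (r : rel T) (X : {set T}).

(** A finite relation has a cycle exactly when some nonempty set has this property; the next two
    lemmas are the two directions. *)
Definition back_closed r X := forall t, t \in X -> exists2 s, s \in X & r s t.

Lemma back_closed_cycle r X : back_closed r X -> X != set0 ->
  exists s t, r s t /\ connect r t s.
Proof.
move=> bX /set0Pn [x xX].
pose f t := odflt t [pick s in X | r s t].
have fP t : t \in X -> f t \in X /\ r (f t) t.
  move=> /bX [s sX rst]; rewrite /f; case: pickP => [u /andP[]//|/(_ s)].
  by rewrite sX rst.
have itX n : iter n f x \in X by elim: n => //= n /fP [].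
have conn k n : connect r (iter (k + n) f x) (iter n f x).
  elim: k => //= k; apply: connect_trans; apply: connect1.
  by case: (fP _ (itX (k + n))).
have /trajectP [i iln e] := looping_order f x.
exists (iter i.+1 f x), (iter i f x); split; first by case: (fP _ (itX i)).
rewrite -e -(subnK iln); exact: conn.
Qed.

(** The points lying on some walk from [t] to [s] will do: each has its predecessor on such a walk,
    and [t] has [s]. *)
Lemma cycle_back_closed r s t : r s t -> connect r t s ->
  exists2 X : {set T}, X != set0 & back_closed r X.
Proof.
move=> rst cts; exists [set z | connect r t z && connect r z s].
  by apply/set0Pn; exists t; rewrite inE connect0.
move=> z; rewrite inE => /andP[tz zs].
have [zt|nzt] := eqVneq z t; first by exists s; rewrite ?inE ?cts ?connect0 ?zt.
case/connectP: tz => p; case/lastP: p => [/= _ e|p y]; first by rewrite e eqxx in nzt.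
rewrite rcons_path last_rcons => /andP[pp rl] e; rewrite -e in rl.
exists (last t p) => //; rewrite inE.
apply/andP; split; first by apply/connectP; exists p.
by apply: connect_trans zs; exact: connect1.
Qed.

(** A set in which every point has a successor contains a cycle of the reversed relation; read
    backwards, it is a cycle of [r]. *)
Lemma forward_back_closed r X : X != set0 ->
    (forall s, s \in X -> exists2 t, t \in X & r s t) ->
  exists Y : {set T}, [/\ Y != set0, Y \subset X & back_closed r Y].
Proof.
move=> X0 fX; pose r' := [rel s t | [&& s \in X, t \in X & r s t]].
have [|t [s [/= /and3P[tX sX rts] c]]] := @back_closed_cycle [rel s t | r' t s] X _ X0.
  by move=> s sX; have [t tX rst] := fX s sX; exists t => //=; rewrite sX tX.
have r'ts : r' s t by rewrite /= tX sX rts.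
have c' : connect r' t s by rewrite connect_rev.
have [Y Y0 bY] := cycle_back_closed r'ts c'.
exists Y; split=> //; first by apply/subsetP => y /bY [? _ /and3P[]].
by move=> y /bY [z zY /and3P[_ _ ?]]; exists z.
Qed.

End Traps.

(** * Acyclic matchings and V-paths *)

Section Acyclic.
Variable V : finType.
Notation simplex := {set V}.
Notation edge := ({set V} * {set V})%type.
Implicit Types (K W X : {set simplex}) (C E M : {set edge}) (s t a b c : simplex) (e x :
  edge).

Lemma facet_card a b : facet a b -> #|b| = #|a|.+1.
Proof. by case/andP => _ /eqP. Qed.

Lemma edgesP W a b : reflect [/\ a \in W, b \in W & facet a b] ((a, b) \in edges W).
Proof. by rewrite inE /=; exact: and3P. Qed.

Lemma edges_sub W K : W \subset K -> edges W \subset edges K.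
Proof.
move=> /subsetP WK; apply/subsetP => -[a b] /edgesP[aW bW f].
by apply/edgesP; split => //; exact: WK.
Qed.

Lemma matchingP E M :
  reflect (M \subset E /\ forall e x, e \in M -> x \in M -> e != x ->
             [disjoint endpoints e & endpoints x])
          (matching E M).
Proof.
apply: (iffP andP) => -[ME dis]; split=> //.
  move=> e x eM xM ne; move/forallP: dis => /(_ e) /implyP /(_ eM) /forallP /(_ x).
  by rewrite xM ne.
apply/forallP => e; apply/implyP => eM; apply/forallP => x; apply/implyP => xM.
by apply/implyP; exact: dis.
Qed.

Lemma matching_sub E M M' : matching E M -> M' \subset M -> matching E M'.
Proof.
move=> /matchingP [ME dis] /subsetP s; apply/matchingP; split.
  by apply/subsetP => e /s; exact: (subsetP ME).
by move=> e x /s eM /s xM; exact: dis.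
Qed.

Lemma matching_subset E E' M : matching E M -> M \subset E' -> matching E' M.
Proof. by case/matchingP => _ dis s; apply/matchingP. Qed.

Lemma matching_common E M e x s : matching E M -> e \in M -> x \in M ->
  s \in endpoints e -> s \in endpoints x -> e = x.
Proof.
move=> /matchingP [_ dis] eM xM se sx; apply/eqP; apply: contraTT sx => ne.
by rewrite (disjointFr (dis _ _ eM xM ne) se).
Qed.

Lemma matching_bottom E M a b c : matching E M ->
  (a, b) \in M -> (a, c) \in M -> b = c.
Proof.
move=> m i j; have [] // : (a, b) = (a, c).
by apply: (@matching_common E M _ _ a m i j); rewrite !inE eqxx.
Qed.

Lemma matching_top E M a b c : matching E M ->
  (a, c) \in M -> (b, c) \in M -> a = b.
Proof.
move=> m i j; have [] // : (a, c) = (b, c).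
by apply: (@matching_common E M _ _ c m i j); rewrite !inE eqxx orbT.
Qed.

Lemma matching_chain W M a b c : matching (edges W) M ->
  (a, b) \in M -> (b, c) \in M -> False.
Proof.
move=> m i j.
have [ab _] : (a, b) = (b, c).
  by apply: (@matching_common _ M _ _ b m i j); rewrite !inE eqxx ?orbT.
have /matchingP [/subsetP /(_ _ i)] := m; rewrite ab => /edgesP [_ _ /facet_card]; lia.
Qed.

Lemma regularP M s : reflect (exists2 e, e \in M & s \in endpoints e) (s \in regular M).
Proof. exact: bigcupP. Qed.

Lemma regular_fst M a b : (a, b) \in M -> a \in regular M.
Proof. by move=> i; apply/regularP; exists (a, b); rewrite // !inE eqxx. Qed.

Lemma regular_snd M a b : (a, b) \in M -> b \in regular M.
Proof. by move=> i; apply/regularP; exists (a, b); rewrite // !inE eqxx orbT. Qed.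

Lemma regularU M M' : regular (M :|: M') = regular M :|: regular M'.
Proof. by rewrite /regular bigcup_setU. Qed.

Lemma regular_edges W M : M \subset edges W -> regular M \subset W.
Proof.
move=> /subsetP ME; apply/subsetP => s /regularP [[a b] /ME /edgesP [aW bW _]].
by rewrite !inE => /orP[] /eqP ->.
Qed.

Lemma matchingU E M M' : matching E M -> matching E M' ->
  [disjoint regular M & regular M'] -> matching E (M :|: M').
Proof.
move=> /matchingP [ME dM] /matchingP [ME' dM'] dis; apply/matchingP; split.
  by rewrite subUset ME.
have cross e x : e \in M -> x \in M' -> [disjoint endpoints e & endpoints x].
  move=> eM xM'; apply/pred0P => s /=; apply/negP => /andP[se sx].
  have : s \in regular M' by apply/regularP; exists x.
  by rewrite (disjointFr dis) //; apply/regularP; exists e.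
move=> e x; rewrite !inE => /orP[] eM /orP[] xM ne; try exact: cross.
- exact: dM.
- by rewrite disjoint_sym; exact: cross.
- exact: dM'.
Qed.

Lemma matching0 E : matching E set0.
Proof. by apply/matchingP; split; rewrite ?sub0set // => e x; rewrite inE. Qed.

Lemma matching1 E e : e \in E -> matching E [set e].
Proof.
move=> eE; apply/matchingP; split; first by rewrite sub1set.
by move=> x y /set1P -> /set1P ->; rewrite eqxx.
Qed.

Lemma card_regular W M : matching (edges W) M -> #|regular M| = 2 * #|M|.
Proof.
move=> m; rewrite /regular; have /matchingP [/subsetP ME dM] := m.
have -> : \bigcup_(e in M) endpoints e = cover (@endpoints V @: M).
  by rewrite cover_imset.
have card2 e : e \in M -> #|endpoints e| = 2.
  case: e => a b /ME /edgesP [_ _ /facet_card h]; rewrite cards2.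
  by case: eqVneq h => //= ->; lia.
have inj : {in M &, injective (@endpoints V)}.
  move=> e x eM xM ex; apply: (@matching_common _ M _ _ e.1 m eM xM).
    by rewrite !inE eqxx.
  by rewrite -ex !inE eqxx.
have /eqP <- : trivIset (@endpoints V @: M).
  apply/trivIsetP => A B /imsetP [e eM ->] /imsetP [x xM ->] ne.
  by apply: dM => //; apply: contraNneq ne => ->.
rewrite (big_imset _ inj) (eq_bigr (fun=> 2) card2) sum_nat_const.
by rewrite mulnC.
Qed.

(* The V-path of M goes down from s to a facet of s and up to t. *)
Definition lead M : rel simplex :=
  [rel s t | (s != t) && [exists a, ((a, t) \in M) && facet a s]].

Lemma leadP M s t :
  reflect (exists a, [/\ (a, t) \in M, facet a s & s != t]) (lead M s t).
Proof.
apply: (iffP andP) => [[ne /existsP [a /andP[? ?]]]|[a [? ? ?]]]; first by exists a.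
by split=> //; apply/existsP; exists a; apply/andP.
Qed.

(** Absence of closed V-paths; by [morse_acyclic] and [acyclic_morse] this is what [morse_matching]
    adds to [matching]. *)
Definition acyclic M := forall X, back_closed (lead M) X -> X = set0.

Lemma acyclic0 : acyclic set0.
Proof.
move=> X bX; apply/setP => s; rewrite inE; apply/negP => /bX [t _ /leadP [a []]].
by rewrite inE.
Qed.

(** The last hypothesis forbids V-paths from a top simplex of [M] to one of [M']. Hence the tops of
    [M'] in a back-closed set form a back-closed set for [M'] alone, which is empty, and only [M]
    remains. *)
Lemma acyclicU M M' : acyclic M -> acyclic M' ->
    [disjoint regular M & regular M'] ->
    (forall a b c d, (a, b) \in M -> (c, d) \in M' -> ~~ facet c b) ->
  acyclic (M :|: M').
Proof.
move=> aM aM' dis cross X bX.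
have XM' : [set t in X | [exists a, (a, t) \in M']] = set0.
  apply: aM' => t; rewrite inE => /andP[tX /existsP [c cM']].
  have [s sX /leadP [b [bt bs st]]] := bX t tX.
  have bM' : (b, t) \in M'.
    case/setUP: bt => // bM; have := regular_snd bM.
    by rewrite (disjointFl dis) //; exact: regular_snd cM'.
  exists s; last by apply/leadP; exists b.
  rewrite inE sX; apply/existsP.
  have [u _ /leadP [d [/setUP [] dM _ _]]] := bX s sX; last by exists d.
  by have := cross _ _ _ _ dM bM'; rewrite bs.
apply: aM => t tX; have [s sX /leadP [b [/setUP [] bt bs st]]] := bX t tX.
  by exists s => //; apply/leadP; exists b.
suff : t \in set0 by rewrite inE.
by rewrite -XM' inE tX; apply/existsP; exists b.
Qed.

Lemma acyclic_forward M X : acyclic M ->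
  (forall s, s \in X -> exists2 t, t \in X & lead M s t) -> X = set0.
Proof.
move=> aM fX; apply/eqP; apply: contraT => X0.
by have [Y [Y0 _ /aM YE]] := forward_back_closed X0 fX; rewrite YE eqxx in Y0.
Qed.

Lemma lead_arc W C M s t : matching (edges W) M -> s \in W ->
    (forall a, (a, s) \in edges W -> (a, s) \in C) ->
    (forall a, (a, t) \in edges W -> (a, t) \in C) -> lead M s t ->
  exists a, Defs.arc C M s a /\ Defs.arc C M a t.
Proof.
move=> m sW sC tC /leadP [a [at' as' st]]; exists a.
have aE := subsetP (proj1 (matchingP _ _ m)) _ at'; have /edgesP [aW tW _] := aE.
have asM : (a, s) \notin M.
  by apply: contraNN st => h; apply/eqP; exact: matching_bottom m h at'.
rewrite /Defs.arc /= !(inE, in_setD) at' asM tC // sC ?orbT //.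
by apply/edgesP.
Qed.

(** Each [lead] step unfolds into a down-edge and an up-edge at its two ends. Allowing a smaller
    edge set [C] makes the lemma apply also to the cycle test of the frontier procedure. *)
Lemma back_closed_dicycle W C M X : matching (edges W) M -> X != set0 ->
    back_closed (lead M) X ->
    (forall s a, s \in X -> (a, s) \in edges W -> (a, s) \in C) ->
  has_dicycle C M.
Proof.
move=> m X0 bX XC.
have XW t : t \in X -> t \in W.
  move=> /bX [s _ /leadP [a [h _ _]]].
  by have /edgesP [_ ? _] := subsetP (proj1 (matchingP _ _ m)) _ h.
pose r := [rel s t | [&& s \in X, t \in X & lead M s t]].
have [|s [t [/and3P[sX tX st] cts]]] := @back_closed_cycle _ r X _ X0.
  by move=> t tX; have [s sX st] := bX t tX; exists s; rewrite //= sX tX.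
have rc (x y : simplex) : r x y -> connect (Defs.arc C M) x y.
  case/and3P => /= xX yX xy.
  have [a [xa ay]] := lead_arc m (XW _ xX) (XC x ^~ xX) (XC y ^~ yX) xy.
  by apply: connect_trans (connect1 xa) (connect1 ay).
have [a [sa ay]] := lead_arc m (XW _ sX) (XC s ^~ sX) (XC t ^~ tX) st.
apply/existsP; exists s; apply/existsP; exists a; rewrite sa.
apply: connect_trans (connect1 ay) _; apply: connect_sub cts => x y; exact: rc.
Qed.

Lemma morse_acyclic K M : morse_matching K M -> acyclic M.
Proof.
case/andP => m nc X bX; apply/eqP; apply: contraNT nc => X0.
exact: (back_closed_dicycle m X0 bX).
Qed.

(* A directed cycle stays between two consecutive dimensions, since after an
   up-edge it has to go down: its simplices of maximum dimension are cyclically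
   ordered by lead. *)
Lemma acyclic_morse K M : matching (edges K) M -> acyclic M -> morse_matching K M.
Proof.
move=> m aM; rewrite /morse_matching m; apply/negP =>
  /existsP [s /existsP [t /andP[st cts]]].
have [X X0 bX] := cycle_back_closed st cts.
have /set0Pn [x xX] := X0.
pose n := \max_(y in X) #|y|.
have [y yX yn] : {y | y \in X & n = #|y|} by apply: eq_bigmax_cond; apply/card_gt0P;
  exists x.
have : [set z in X | #|z| == n] = set0; last first.
  by move=> /setP /(_ y); rewrite !inE yX yn eqxx.
apply: aM => u; rewrite inE => /andP[uX /eqP un].
have le z : z \in X -> #|z| <= n by move=> zX; exact: leq_bigmax_cond.
have [v vX /orP [/setIP [/edgesP [_ _ vu] vM]|/setDP [/edgesP [_ _ uv] _]]] := bX u uX;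
  last first.
  by have := le v vX; rewrite -un (facet_card uv); lia.
have [w wX /orP [/setIP [_ wM]|/setDP [/edgesP [_ _ vw] vwM]]] := bX v vX.
  by case: (matching_chain m wM vM).
exists w; first by rewrite inE wX (facet_card vw) -(facet_card vu) un eqxx.
apply/leadP; exists v; split=> //.
by apply: contraNneq vwM => ->.
Qed.

End Acyclic.

(** * The frontier procedure *)

Section Frontier.
Variable V : finType.
Notation simplex := {set V}.
Notation edge := ({set V} * {set V})%type.
Variable W : {set simplex}.
Implicit Types (A B X : {set simplex}) (C E M U : {set edge}) (s t a b c : simplex).
Implicit Types (e x y : edge) (q r : seq edge).

Definition edges_at B : {set edge} := [set e in edges W | e.2 \in B].

Definition acyclic_on U B :=
  forall X, X \subset B -> back_closed (lead U) X -> X = set0.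

(* [A] holds the cofacets whose edges have already been moved to the output, [B]
   those whose edges are in the collected set, [q] is the queue and [r] lists
   the leading up-edges still to be examined. *)
Record frontier_state A B U q r : Prop := FrontierState {
  fs_matching : matching (edges W) U;
  fs_disjoint : [disjoint B & A];
  fs_queue : {subset q <= edges_at (~: A)};
  fs_uniq : uniq r;
  fs_rest : {subset r <= edges_at (~: A) :&: U};
  fs_acyclic : forall X, X \subset B -> back_closed (lead U) X -> X != set0 ->
    exists2 y, y \in r & y.2 \in X;
  fs_closed : forall a s t, s \in B -> (a, s) \in U -> lead U s t -> t \notin A ->
    (t \in B) || (t \in [seq y.2 | y <- q ++ r]) }.

Lemma facet_edgesE A s : s \notin A ->
  facet_edges (edges_at (~: A)) s = edges_at [set s].
Proof.
move=> sA; apply/setP => e; rewrite !inE.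
by case: eqP => [->|]; rewrite ?sA ?andbF ?andbT.
Qed.

Lemma edges_atU B B' : edges_at (B :|: B') = edges_at B :|: edges_at B'.
Proof. by apply/setP => e; rewrite !inE andb_orr. Qed.

Lemma lead_top U s t : lead U s t -> exists a, (a, t) \in U.
Proof. by case/leadP => a []; exists a. Qed.

Lemma lead_subset U U' s t : U' \subset U -> lead U' s t -> lead U s t.
Proof. by move=> /subsetP sub /leadP [a [/sub ? ? ?]]; apply/leadP; exists a. Qed.

Lemma back_closed_subset U U' X : U' \subset U ->
  back_closed (lead U') X -> back_closed (lead U) X.
Proof. by move=> sub bX t /bX [s sX /(lead_subset sub)]; exists s. Qed.

(** A reversed edge leaves [y.2] without a matched facet, so [y.2] can be added to [B] without lying
    in a back-closed set. An enqueued edge leaves [B] as it is. *)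
Lemma foldl_frontier_check A B U q r C1 U1 q1 :
    frontier_state A B U q r ->
    foldl (frontier_check (edges_at (~: A))) (edges_at B, U, q) r = (C1, U1, q1) ->
  exists2 B1, C1 = edges_at B1 &
    [/\ frontier_state A B1 U1 q1 [::], B \subset B1, U1 \subset U,
        U :\: U1 \subset edges_at (~: A) & {subset q <= q1}].
Proof.
elim: r B U q => [|y r IH] B U q [mU dBA qA ur rA ac cl] /=.
  by case=> <- <- <-; exists B => //; split=> //; rewrite setDv sub0set.
have /setIP [yA yU] : y \in edges_at (~: A) :&: U by apply: rA; rewrite inE eqxx.
have /setIdP [yE] := yA; rewrite inE => ynA.
case/andP: ur => yr ur.
rewrite facet_edgesE // -edges_atU; case: ifPn => cyc.
- have sub : U :\ y \subset U by exact: subsetDl.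
  have top a : (a, y.2) \notin U :\ y.
    rewrite in_setD1; apply/andP => -[/eqP ne aU]; apply: ne.
    by apply: (matching_common (s := y.2) mU) => //; rewrite !inE eqxx orbT.
  case/IH.
    split=> //.
    + exact: matching_sub mU sub.
    + rewrite disjoints_subset subUset -disjoints_subset dBA sub1set inE; exact: ynA.
    + move=> e er; have /setIP [eA eU] : e \in edges_at (~: A) :&: U by apply: rA;
        rewrite inE er orbT.
      rewrite in_setI eA in_setD1 eU andbT /=.
      by apply: contraNneq yr => <-.
    + move=> X XB bX X0; have yX : y.2 \notin X.
        by apply/negP => /bX [s _ /lead_top [a]]; rewrite (negbTE (top a)).
      have XsB : X \subset B.
        apply/subsetP => s sX; have /setUP [//|/set1P e] := subsetP XB _ sX.
        by rewrite -e sX in yX.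
      have [e] := ac X XsB (back_closed_subset sub bX) X0.
      by rewrite inE => /predU1P [->|er eX]; [rewrite (negbTE yX) | exists e].
    + move=> a s t sB aU st tA.
      have {}sB : s \in B.
        by case/setUP: sB => // /set1P e; have := top a; rewrite -e aU.
      have := cl a s t sB (subsetP sub _ aU) (lead_subset sub st) tA.
      rewrite !map_cat !mem_cat /= !inE.
      by case: (t \in B) => //=; case: (t == y.2).
  move=> B1 -> [fs BB1 U1U UU1 qq1]; exists B1 => //; split=> //.
  + exact: subset_trans (subsetUl _ _) BB1.
  + exact: subset_trans U1U sub.
  + apply/subsetP => e /setDP [eU eU1]; have [-> //|ne] := eqVneq e y.
    by apply: (subsetP UU1); rewrite in_setD eU1 in_setD1 ne.
- case/IH.
    split=> //.
    + by move=> e; rewrite mem_rcons inE => /predU1P [->|/qA].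
    + by move=> e er; apply: rA; rewrite inE er orbT.
    (* The negative cycle test, made on a set larger than [C], already excludes every closed V-path
       in [B], so no witness in [r] has to be found. *)
    + move=> X XB bX X0; case/negP: cyc.
      apply: (back_closed_dicycle mU X0 bX) => s a sX asW.
      by apply/setIdP; split; rewrite // in_setU (subsetP XB).
    + move=> a s t sB aU st tA; have := cl a s t sB aU st tA.
      by rewrite cat_rcons.
  move=> B1 -> [fs BB1 U1U UU1 qq1]; exists B1 => //; split=> //.
  by move=> e eq; apply: qq1; rewrite mem_rcons inE eq orbT.
Qed.

(** A new closed V-path has to pass through [x.2] and to leave it along a leading up-edge. All of
    these are in [r], waiting to be examined, which is why [fs_acyclic] allows for witnesses in
    [r]. *)
Lemma frontier_state_dequeue A B U x q r :
    perm_eq r (enum (leading_up_edges (edges_at (~: A)) U x)) ->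
    frontier_state A B U (x :: q) [::] ->
  frontier_state A (x.2 |: B) U q r.
Proof.
move=> rE [mU dBA qA _ _ ac cl].
have memr e : (e \in r) = (e \in leading_up_edges (edges_at (~: A)) U x).
  by rewrite (perm_mem rE) mem_enum.
have xA : x \in edges_at (~: A) by apply: qA; rewrite inE eqxx.
have /setIdP [xE] := xA; rewrite inE => xnA.
have xW : x.2 \in W by move: xE; case: (x) => a b /edgesP [].
have leadr t : lead U x.2 t -> t \notin A -> exists2 y, y \in r & y.2 = t.
  move=> /leadP [a [aU ax xt]] tA; exists (a, t) => //.
  have aE := subsetP (proj1 (matchingP _ _ mU)) _ aU.
  have axU : (a, x.2) \notin U.
    by apply: contraNN xt => axU; apply/eqP; exact: matching_bottom mU axU aU.
  rewrite memr; apply/setIdP; rewrite in_setI in_setD aU axU andbT; split.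
    by apply/setIdP; rewrite aE inE.
  apply/setIdP; split; last by rewrite inE.
  by have /edgesP [aW _ _] := aE; apply/edgesP.
split=> //.
- by rewrite disjoints_subset subUset sub1set inE xnA -disjoints_subset.
- by move=> e eq; apply: qA; rewrite inE eq orbT.
- by rewrite (perm_uniq rE) enum_uniq.
- by move=> e; rewrite memr => /setIdP [].
- move=> X XB bX X0; have dX t : t \in X -> t \notin A.
    move=> tX; apply: contraL (subsetP XB _ tX) =>
      tA; rewrite !inE negb_or (disjointFl dBA tA) andbT.
    by apply: contraNneq xnA => <-.
  have [/existsP [t /andP[tX xt]]|no] := boolP [exists t, (t \in X) && lead U x.2 t].
    by have [y yr yt] := leadr t xt (dX t tX); exists y; rewrite ?yt.
  have XxE : X :\ x.2 = set0.
    apply/eqP; apply: contraT => Xx0; have [] := ac (X :\ x.2) _ _ Xx0.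
    - by rewrite subDset.
    - move=> t /setD1P [_ tX]; have [s sX st] := bX t tX; exists s => //.
      rewrite in_setD1 sX andbT; apply: contraNneq no => sx; apply/existsP; exists t.
      by rewrite tX -sx.
    - by move=> ?; rewrite inE.
  have /set0Pn [t tX] := X0; have [s sX st] := bX t tX.
  have ex u : u \in X -> u = x.2.
    by move=> uX; apply: contraTeq isT => ne; move/setP: XxE => /(_ u); rewrite !inE uX ne.
  by have /leadP [a [_ _]] := st; rewrite (ex t tX) (ex s sX) eqxx.
- move=> a s t /setU1P [-> _ /leadr h /h [y yr <-]|sB aU st tA].
    by rewrite map_cat mem_cat (map_f (fun y => y.2) yr) !orbT.
  have := cl a s t sB aU st tA; rewrite cats0 in_setU1 map_cat mem_cat /= inE.
  by case: (t \in B); case: (t == x.2) => //= ->.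
Qed.

Lemma frontier_queue_step A B U x q r C1 U1 q1 :
    perm_eq r (enum (leading_up_edges (edges_at (~: A)) U x)) ->
    foldl (frontier_check (edges_at (~: A)))
      (edges_at B :|: facet_edges (edges_at (~: A)) x.2, U, q) r = (C1, U1, q1) ->
    frontier_state A B U (x :: q) [::] ->
  exists2 B1, C1 = edges_at B1 &
    [/\ frontier_state A B1 U1 q1 [::], x.2 |: B \subset B1, U1 \subset U &
        U :\: U1 \subset edges_at (~: A)].
Proof.
move=> rE fE fs; have fs' := frontier_state_dequeue rE fs.
have xA : x.2 \notin A.
  by have /setIdP [_] := fs_queue fs (mem_head x q); rewrite inE.
move: fE; rewrite facet_edgesE // setUC -edges_atU => /(foldl_frontier_check fs').
by case=> B1 -> [? ? ? ? _]; exists B1.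
Qed.

Lemma frontier_queue_state A U q C C' U' :
    frontier_queue (edges_at (~: A)) C U q C' U' ->
    forall B, C = edges_at B -> frontier_state A B U q [::] ->
  exists2 B', C' = edges_at B' &
    [/\ frontier_state A B' U' [::] [::], B \subset B', (forall x, ohead q = Some x ->
      x.2 \in B'),
        U' \subset U & U :\: U' \subset edges_at (~: A)].
Proof.
elim=> {U q C C' U'} [C U B -> fs|C U x q r C1 U1 q1 C' U' rE fE _ IH B CE fs].
  by exists B => //; split=> //; rewrite setDv sub0set.
rewrite CE in fE; have fs' := frontier_state_dequeue rE fs.
have [B1 C1E [fs1 BB1 U1U UU1]] := frontier_queue_step rE fE fs.
have [B' C'E [fs2 B1B' qB' U'U1 U1U']] := IH B1 C1E fs1.
have xB' : x.2 \in B' by apply: (subsetP B1B'); apply: (subsetP BB1); rewrite in_setU1 eqxx.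
exists B' => //; split=> //.
- by apply: subset_trans B1B'; apply: subset_trans BB1; exact: subsetUr.
- by move=> _ [<-].
- exact: subset_trans U'U1 U1U.
- apply/subsetP => e /setDP [eU eU']; have [eU1|eU1] := boolP (e \in U1).
    by apply: (subsetP U1U'); rewrite in_setD eU1 eU'.
  by apply: (subsetP UU1); rewrite in_setD eU1 eU.
Qed.

Lemma frontier_state0 A U x : matching (edges W) U -> x \in edges_at (~: A) ->
  frontier_state A set0 U [:: x] [::].
Proof.
move=> mU xA; split=> //.
- by rewrite disjoints_subset sub0set.
- by move=> e; rewrite inE => /eqP ->.
- by move=> X; rewrite subset0 => /eqP -> _; rewrite eqxx.
- by move=> a s t; rewrite inE.
Qed.

Lemma edges_at0 : edges_at set0 = set0.
Proof. by apply/setP => e; rewrite !inE andbF. Qed.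

Lemma edges_atD A B : edges_at (~: A) :\: edges_at B = edges_at (~: (A :|: B)).
Proof.
apply/setP => e; rewrite !inE negb_or.
by case: (e.2 \in A); case: (e.2 \in B); rewrite ?andbT ?andbF //= andNb.
Qed.

(** The invariant has two halves: there is no closed V-path among the processed cofacets [A], and no
    V-path leaves [A]. The second half keeps a closed V-path from mixing [A] with the newly
    collected [B]. *)
Lemma frontier_loop_acyclic E U U' : frontier_loop E U U' ->
    forall A, E = edges_at (~: A) -> matching (edges W) U -> acyclic_on U A ->
    (forall a s t, s \in A -> (a, s) \in U -> lead U s t -> t \in A) ->
  U' \subset U /\ acyclic U'.
Proof.
elim=> {E U U'} [E U EU A EE mU ac cl|E U x C U1 U' xEU qE _ IH A EE mU ac cl].
  (* When no up-edge is left in [E], every matched cofacet is in [A]. *)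
  split=> // X bX; apply: ac => //; apply/subsetP => t tX.
  have [s _ /leadP [a [aU _ _]]] := bX t tX.
  apply: contraT => tA; have : (a, t) \in set0; last by rewrite inE.
  rewrite -EU EE in_setI aU andbT; apply/setIdP; split; last by rewrite inE.
  exact: subsetP (proj1 (matchingP _ _ mU)) _ aU.
case/setIP: xEU => xE xU; rewrite EE in xE qE.
have fs0 := frontier_state0 mU xE.
have [B C_E [fs _ _ U1U UU1]] := frontier_queue_state qE (esym edges_at0) fs0.
have mU1 := fs_matching fs.
have E'E : E :\: C = edges_at (~: (A :|: B)) by rewrite EE C_E edges_atD.
have cl1 a s t : s \in A -> (a, s) \in U1 -> lead U1 s t -> t \in A.
  by move=> sA aU1 /(lead_subset U1U); apply: cl sA (subsetP U1U _ aU1).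
have [] := IH _ E'E mU1; last by move=> U'U1 aU'; split; first exact: subset_trans U1U.
- move=> X XAB bX.
  have XA : X :\: A = set0.
    apply/eqP; apply: contraT => X0; have [||y] // := fs_acyclic fs _ _ X0.
    + by rewrite subDset.
    + move=> t /setDP [tX tA]; have [s sX st] := bX t tX; exists s => //.
      rewrite in_setD sX andbT; apply: contra tA => sA.
      by have [u _ /lead_top [a aU1]] := bX s sX; exact: cl1 sA aU1 st.
  apply: ac; last exact: back_closed_subset bX.
  apply/subsetP => t tX; apply: contraT => tA.
  by have := in_set0 t; rewrite -XA in_setD tX tA.
- move=> a s t /setUP sAB aU1 st; rewrite in_setU.
  have [//|tA] := boolP (t \in A).
  case: sAB => [sA|sB]; first by rewrite (cl1 a s t) in tA.
  by have := fs_closed fs sB aU1 st tA; rewrite orbF.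
Qed.

Lemma frontier_acyclic M : frontier W M -> matching (edges W) M /\ acyclic M.
Proof.
case=> M0 [mM0 _] loop.
have [||X|? ? ? /[!inE]//|MM0 aM] := frontier_loop_acyclic (A := set0) loop.
- by apply/setP => e; rewrite !inE andbT.
- by [].
- by rewrite subset0 => /eqP.
by split=> //; exact: matching_sub MM0.
Qed.

Lemma foldl_check_shrinks E C U q r C1 U1 q1 : uniq r -> {subset r <= U} ->
  foldl (frontier_check E) (C, U, q) r = (C1, U1, q1) ->
  (#|U1| < #|U|) || ((C1, U1, q1) == (C, U, q ++ r)).
Proof.
elim: r C U q => [|y r IH] C U q /= => [_ _ <-|/andP[yr ur] sub].
  by rewrite cats0 eqxx orbT.
case: ifP => _ e; last first.
  rewrite -cat_rcons; apply: IH ur _ e => z zr; apply: sub; by rewrite inE zr orbT.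
have yU : y \in U by apply: sub; rewrite inE eqxx.
apply/orP; left; rewrite (cardsD1 y U) yU add1n ltnS.
have := IH _ _ _ ur _ e; case/(_ _)/orP => [z zr|/ltnW//|/eqP[_ -> _]//].
by rewrite in_setD1 sub ?inE ?zr ?orbT // andbT; apply: contraNneq yr => <-.
Qed.

(* Before any up-edge is reversed and any new edge is collected, the search only
   follows V-paths in the acyclic collected set. *)
Lemma frontier_queue_exists A B U q : frontier_state A B U q [::] ->
  exists C' U', frontier_queue (edges_at (~: A)) (edges_at B) U q C' U'.
Proof.
(* Lexicographic measure: a reversal decreases [U]; without one, a newly collected cofacet decreases
   the complement of [B]; otherwise the weight [w] of the queue decreases. *)
have [n le_n] := ubnP #|U|; elim: n => // n IHn in U B q le_n *.
have [m le_m] := ubnP #|~: B|; elim: m => // m IHm in B q le_m *.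
pose r' B := [rel s t | (s \in B) && lead U s t].
(* Dequeuing replaces an edge by at most [#|U|] edges of smaller [h]; the base [#|U|.+1] makes their
   total weight smaller than the one removed. *)
pose h B s := #|[set t | connect (r' B) s t]|.
pose w B q := \sum_(y <- q) #|U|.+1 ^ h B y.2.
have [k le_k] := ubnP (w B q); elim: k => // k IHk in q le_k *.
case: q le_k => [|x q] le_k fs; first by exists (edges_at B), U; constructor.
pose r := enum (leading_up_edges (edges_at (~: A)) U x).
case fE: (foldl (frontier_check (edges_at (~: A)))
      (edges_at B :|: facet_edges (edges_at (~: A)) x.2, U, q) r) => [[C1 U1] q1].
have rr : perm_eq r (enum (leading_up_edges (edges_at (~: A)) U x)) by [].
have [B1 C1E [fs1 BB1 U1U UU1]] := frontier_queue_step rr fE fs.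
suff [C' [U' run]] : exists C' U', frontier_queue (edges_at (~: A)) C1 U1 q1 C' U'.
  by exists C', U'; apply: frontier_dequeue rr fE _.
have rU : {subset r <= U}.
  by move=> e; rewrite mem_enum => /setIdP [/setIP []].
case/orP: (foldl_check_shrinks (enum_uniq _) rU fE) => [lt|/eqP [C1E' U1E q1E]].
  by rewrite C1E; apply: IHn fs1; lia.
subst U1 q1.
have [xB|xB] := boolP (x.2 \in B); last first.
  rewrite C1E; apply: IHm fs1; suff : #|~: B1| < #|~: B| by lia.
  apply: proper_card; rewrite properC; apply/properP; split.
    by apply: subset_trans BB1; exact: subsetUr.
  by exists x.2 => //; apply: (subsetP BB1); rewrite in_setU1 eqxx.
have xnA : x.2 \notin A by have /setIdP [_] := fs_queue fs (mem_head x q); rewrite inE.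
have xBB : x.2 |: B = B by apply/setUidPr; rewrite sub1set.
rewrite C1E' facet_edgesE // setUC -edges_atU xBB.
have fsr := frontier_state_dequeue rr fs; rewrite xBB in fsr.
have fs2 : frontier_state A B U (q ++ r) [::].
  case: fs fsr => [mU dBA qA _ _ ac _] [_ _ _ ur rA _ cl]; split=> //.
  - move=> e; rewrite mem_cat => /orP[er|/rA /setIP[]//]; apply: qA.
    by rewrite inE er orbT.
  - by rewrite cats0.
apply: IHk fs2; suff : w B (q ++ r) < w B (x :: q) by lia.
rewrite /w big_cat big_cons /= addnC ltn_add2r.
have hlt y : y \in r -> h B y.2 < h B x.2.
  rewrite mem_enum => /setIdP [/setIP [_ yU] /setDP [yx yxU]].
  have xy : lead U x.2 y.2.
    apply/leadP; exists y.1; split; first by case: (y) yU.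
      by have /setIdP [/edgesP [] ] := yx.
    by apply: contraNneq yxU => ->; case: (y) yU.
  have r'xy : r' B x.2 y.2 by rewrite /= xB.
  apply: proper_card; apply/properP; split.
    by apply/subsetP => t; rewrite !inE; apply: connect_trans; exact: connect1.
  exists x.2; rewrite !inE ?connect0 //; apply/negP => cyx.
  (* A V-path back to [x.2] would close up inside [B], contrary to [fs_acyclic] with an empty
     rest. *)
  have [X X0 bX] := @cycle_back_closed _ (r' B) _ _ r'xy cyx.
  have XB : X :&: B = set0.
    apply/eqP; apply: contraT => XB0; have [||e] // := fs_acyclic fs _ _ XB0.
    - exact: subsetIr.
    - move=> t /setIP [/bX [s sX /andP[sB st]] _]; exists s => //.
      by rewrite in_setI sX.
  have /set0Pn [t /bX [s sX /andP[sB _]]] := X0.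
  by have := in_set0 s; rewrite -XB in_setI sX sB.
have rsize : size r <= #|U| by rewrite [#|U|]cardE uniq_leq_size ?enum_uniq // =>
  e /rU; rewrite mem_enum.
apply: (@leq_ltn_trans (\sum_(y <- r) #|U|.+1 ^ (h B x.2).-1)).
  rewrite big_seq [X in _ <= X]big_seq; apply: leq_sum => y /hlt lt.
  by rewrite leq_pexp2l //; lia.
rewrite big_const_seq count_predT iter_addn addn0 mulnC.
have hx : 0 < h B x.2 by apply/card_gt0P; exists x.2; rewrite inE connect0.
rewrite -{2}(prednK hx) expnS ltn_pmul2r ?expn_gt0 //; lia.
Qed.

Lemma frontier_loop_exists A U : matching (edges W) U ->
  exists U', frontier_loop (edges_at (~: A)) U U'.
Proof.
have [n] := ubnP #|~: A|; elim: n => // n IH in A U * => le_n mU.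
have [EU|] := eqVneq (edges_at (~: A) :&: U) set0; first by exists U; constructor.
case/set0Pn => x xEU; have /setIP [xE _] := xEU.
have fs0 := frontier_state0 mU xE.
have [C [U1 qE]] := frontier_queue_exists fs0.
rewrite edges_at0 in qE.
have [B C_E [fs _ xB U1U UU1]] := frontier_queue_state qE (esym edges_at0) fs0.
have [|U' loop] := IH (A :|: B) U1 _ (fs_matching fs).
  suff : #|~: (A :|: B)| < #|~: A| by lia.
  apply: proper_card; rewrite properC; apply/properP; split; first exact: subsetUl.
  exists x.2; first by rewrite in_setU (xB x) ?orbT.
  by have /setIdP [_] := xE; rewrite inE.
by exists U'; apply: frontier_loop_step xEU qE _; rewrite C_E edges_atD.
Qed.

Lemma frontier_exists : exists M, frontier W M.
Proof.
have [M0 mM0 max] : {M0 | matching (edges W) M0 & forall M, matching (edges W) M -> #|M|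
  <= #|M0|}.
  case: (@arg_maxnP _ set0 (matching (edges W)) (fun M => #|M|)) => [|M mM max].
    exact: matching0.
  by exists M.
have [U loop] := frontier_loop_exists set0 mM0.
exists U; exists M0 => //; rewrite (_ : edges W = edges_at (~: set0)) //.
by apply/setP => e; rewrite !inE andbT.
Qed.

End Frontier.

(** * Depth-first search *)

Section DFS.
Variable V : finType.
Notation simplex := {set V}.
Notation edge := ({set V} * {set V})%type.
Variables (inc : rel simplex) (N A : {set simplex}).
Implicit Types (v w a u : simplex) (M Y : {set edge}) (p : seq simplex) (R visited : {set
  simplex}).

Definition adjacent : rel simplex :=
  [rel v w | [&& v \in N, w \in N & [exists a in A, joins inc a v w]]].

Lemma adjacentP v w :
  reflect (exists a, [/\ v \in N, w \in N, a \in A & joins inc a v w]) (adjacent v w).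
Proof.
apply: (iffP and3P) => [[vN wN /existsP [a /andP[? ?]]]|[a [? ? ? ?]]]; first by exists a.
by split=> //; apply/existsP; exists a; apply/andP.
Qed.

Lemma joinsC a v w : joins inc a v w = joins inc a w v.
Proof. by rewrite /joins eq_sym [inc v a && _]andbC. Qed.

(** [R] is the set of roots. In [dfs_acyclic], [y.1] is the other end of the tree edge [x.2], thus
    the parent of [x.1]; the field says that parents lead to a root. Phrased with [inc] only, it
    serves both the vertex graph and the dual graph. *)
Record dfs_spec M R : Prop := DfsSpec {
  dfs_roots : R \subset N;
  dfs_pair : forall w a, (w, a) \in M -> [/\ w \in N, w \notin R, a \in A & inc w a];
  dfs_cover : forall v, v \in N -> v \notin R -> exists a, (v, a) \in M;
  dfs_fst : forall w a b, (w, a) \in M -> (w, b) \in M -> a = b;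
  dfs_snd : forall w w' a, (w, a) \in M -> (w', a) \in M -> w = w';
  dfs_card : #|N| = #|R| + #|M|;
  dfs_acyclic : forall Y, Y \subset M ->
    (forall x, x \in Y -> exists y, [/\ y \in Y, y != x & inc y.1 x.2]) -> Y = set0;
  dfs_separated : forall r r', r \in R -> r' \in R -> connect adjacent r r' -> r = r' }.

Hypothesis two_ends : forall a v w u, a \in A -> v \in N -> w \in N -> u \in N ->
  joins inc a v w -> inc u a -> u = v \/ u = w.

(** Two fields drive the induction. [ds_closed] makes the visited set a union of components once the
    stack is empty, and [ds_ends] keeps an unvisited node from being an end of an edge already
    matched. *)
Record dfs_state visited p M R : Prop := DfsState {
  ds_visited : visited \subset N;
  ds_stack : {subset p <= visited};
  ds_closed : forall u w, u \in visited -> u \notin p -> adjacent u w -> w \in visited;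
  ds_roots : R \subset visited;
  ds_pair : forall w a, (w, a) \in M -> [/\ w \in visited, w \notin R, a \in A & inc w a];
  ds_ends : forall w a u, (w, a) \in M -> u \in N -> inc u a -> u \in visited;
  ds_cover : forall v, v \in visited -> v \notin R -> exists a, (v, a) \in M;
  ds_fst : forall w a b, (w, a) \in M -> (w, b) \in M -> a = b;
  ds_snd : forall w w' a, (w, a) \in M -> (w', a) \in M -> w = w';
  ds_card : #|visited| = #|R| + #|M|;
  ds_acyclic : forall Y, Y \subset M ->
    (forall x, x \in Y -> exists y, [/\ y \in Y, y != x & inc y.1 x.2]) -> Y = set0;
  ds_separated : forall r r', r \in R -> r' \in R -> connect adjacent r r' -> r = r' }.

Lemma invariant_connect (visited : {set simplex}) :
  (forall u w, u \in visited -> adjacent u w -> w \in visited) ->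
  forall u w, u \in visited -> connect adjacent u w -> w \in visited.
Proof.
move=> cl u w uv /connectP [p]; elim: p u uv =>
  [u uv _ -> //|x p IH u uv /= /andP[ux xp] e].
by apply: IH xp e; exact: cl ux.
Qed.

Lemma adjacent_sym : connect_sym adjacent.
Proof.
apply: sym_connect_sym => v w.
by apply/adjacentP/adjacentP => -[a [? ? ? ?]]; exists a; rewrite joinsC.
Qed.

Lemma dfs_run_spec visited p M M' : dfs_run inc N A visited p M M' ->
  forall R, dfs_state visited p M R -> exists R', dfs_spec M' R'.
Proof.
elim=> {visited p M M'}.
- move=> visited M Nvis R st.
  have vN : visited = N by apply/eqP; rewrite eqEsubset (ds_visited st).
  by exists R; case: st; rewrite vN; split.
- move=> visited v M M' /setDP [vN vnv] _ IH R st.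
  have cl u w : u \in visited -> adjacent u w -> w \in visited by move=> uv;
    apply: (ds_closed st).
  have vR : v \notin R by apply: contra vnv; exact: (subsetP (ds_roots st)).
  apply: (IH (v |: R)); split.
  + by rewrite subUset sub1set vN (ds_visited st).
  + by move=> u; rewrite inE => /eqP ->; rewrite !inE eqxx.
  + move=> u w /setU1P [->|uv]; first by rewrite inE eqxx.
    by move=> _ /(cl _ _ uv) wv; rewrite in_setU1 wv orbT.
  + exact: setUS (ds_roots st).
  + move=> w a waM; have [wv wR aA wa] := ds_pair st waM; split=> //.
      by rewrite in_setU1 wv orbT.
    by rewrite in_setU1 negb_or wR andbT; apply: contraNneq vnv => <-.
  + by move=> w a u waM uN ua; rewrite in_setU1 (ds_ends st waM uN ua) orbT.
  + move=> u; rewrite !in_setU1 negb_or => uv /andP[/negbTE uv' uR].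
    by apply: (ds_cover st); rewrite ?uR //; rewrite uv' in uv.
  + exact: ds_fst st.
  + exact: ds_snd st.
  + by rewrite !cardsU1 vnv vR (ds_card st); lia.
  + exact: ds_acyclic st.
  (* With an empty stack the visited set is closed under adjacency, so no earlier root reaches the
     unvisited [v]. *)
  + have sep r : r \in R -> ~~ connect adjacent r v.
      move=> rR; apply: contra vnv; apply: invariant_connect cl _ _ _.
      exact: (subsetP (ds_roots st)).
    move=> r r' /setU1P [->|rR] /setU1P [->|r'R] //.
    * by rewrite adjacent_sym (negbTE (sep r' r'R)).
    * by rewrite (negbTE (sep r rR)).
    * exact: ds_separated st _ _ _ _.
- move=> visited v p w a M M' /and3P[/setDP [wN wnv] aA j] _ IH R st.
  have vv : v \in visited by apply: (ds_stack st); rewrite inE eqxx.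
  have vN := subsetP (ds_visited st) _ vv.
  have [vw va wa] := and3P j.
  have wM b : (w, b) \notin M by apply: contra wnv => /(ds_pair st) [].
  have aM u : (u, a) \notin M by apply: contra wnv => uaM; exact: (ds_ends st uaM).
  apply: (IH R); split.
  + by rewrite subUset sub1set wN (ds_visited st).
  + move=> u; rewrite inE => /predU1P [->|up]; first by rewrite !inE eqxx.
    by rewrite in_setU1 (ds_stack st up) orbT.
  + move=> u x /setU1P [->|uv]; first by rewrite inE eqxx.
    rewrite inE negb_or => /andP[_ up] /(ds_closed st uv up) xv.
    by rewrite in_setU1 xv orbT.
  + by apply: subset_trans (ds_roots st) _; exact: subsetUr.
  + move=> x b /setU1P [[-> ->]|/(ds_pair st) [xv xR bA xb]].
      rewrite in_setU1 eqxx; split=> //; apply: contra wnv.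
      exact: (subsetP (ds_roots st)).
    by rewrite in_setU1 xv orbT.
  + move=> x b u /setU1P [[_ ->]|xbM] uN ub; rewrite in_setU1.
      by have [->|->] := two_ends aA vN wN uN j ub; rewrite ?vv ?eqxx ?orbT.
    by rewrite (ds_ends st xbM) ?orbT.
  + move=> u /setU1P [->|uv] uR; first by exists a; rewrite !inE eqxx.
    by have [b ub] := ds_cover st uv uR; exists b; rewrite in_setU1 ub orbT.
  + move=> x b c /setU1P [xb|xb] /setU1P [xc|xc].
    * by case: xb => _ ->; case: xc => _ ->.
    * by case: xb => xw _; rewrite xw (negbTE (wM c)) in xc.
    * by case: xc => xw _; rewrite xw (negbTE (wM b)) in xb.
    * exact: ds_fst st _ _ _ xb xc.
  + move=> x y b /setU1P [xb|xb] /setU1P [yb|yb].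
    * by case: xb => -> _; case: yb => -> _.
    * by case: xb => _ ba; rewrite ba (negbTE (aM y)) in yb.
    * by case: yb => _ ba; rewrite ba (negbTE (aM x)) in xb.
    * exact: ds_snd st _ _ _ xb yb.
  + by rewrite !cardsU1 wnv (wM a) (ds_card st); lia.
  + move=> Y YM cyc.
    (* The new node [w] is the parent of no earlier node, so the new pair can be removed from [Y];
       alone it would have to be its own parent. *)
    have nw x y : x \in Y -> x != (w, a) -> inc y.1 x.2 -> y != (w, a).
      move=> xY ne yx; apply: contraNneq wnv => ye; rewrite ye /= in yx.
      have : x \in M by have := subsetP YM _ xY; rewrite in_setU1 (negbTE ne).
      by case: (x) yx => b c /= yx bcM; exact: (ds_ends st bcM).
    have Y0 : Y :\ (w, a) = set0.
      apply: (ds_acyclic st); first by rewrite subDset.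
      move=> x /setD1P [ne xY]; have [y [yY yx ixy]] := cyc x xY.
      by exists y; rewrite in_setD1 yY (nw x).
    apply/setP => x; rewrite in_set0; apply/negP => xY.
    have [y [yY ne i]] := cyc x xY.
    have in0 z : z \in Y -> z = (w, a).
      by move=> zY; apply: contraTeq isT =>
        zn; have := in_set0 z; rewrite -Y0 in_setD1 zn zY.
    by rewrite (in0 x xY) (in0 y yY) eqxx in ne.
  + exact: ds_separated st.
- move=> visited v p M M' noadv _ IH R st; apply: (IH R); case: st =>
    dv dstk dcl dr dp de dc df dsn dca da ds.
  split=> //.
  + by move=> u up; apply: dstk; rewrite inE up orbT.
  + move=> u w uv up uw; have [e|ne] := eqVneq u v; last by apply: (dcl u) =>
      //; rewrite inE negb_or ne.
    apply: contraT => wv; have /adjacentP [a [_ wN aA j]] := uw.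
    by have := noadv w a; rewrite /advances in_setD wv wN aA -e j.
Qed.

Lemma dfs_optimal_spec M : dfs_optimal inc N A M -> exists R, dfs_spec M R.
Proof.
move/dfs_run_spec; apply; split=> //.
- exact: sub0set.
- by move=> u w; rewrite inE.
- by move=> w a; rewrite inE.
- by move=> w a u; rewrite inE.
- by move=> v; rewrite inE.
- by move=> w a b; rewrite inE.
- by move=> w w' a; rewrite inE.
- by rewrite !cards0.
- by move=> Y; rewrite subset0 => /eqP ->.
- by move=> r r'; rewrite inE.
Qed.

Lemma dfs_run_exists visited p M : exists M', dfs_run inc N A visited p M M'.
Proof.
have [n] := ubnP #|N :\: visited|; elim: n => // n IHn in visited p M *.
have vsub v : v \in N :\: visited -> #|N :\: (v |: visited)| < #|N :\: visited|.
  move=> /setDP [vN vv]; apply: proper_card; apply/properP; split.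
    by apply: setDS; exact: subsetUr.
  by exists v; rewrite !inE ?vv ?vN ?eqxx.
elim: p M => [|v p IHp] M le.
  have [sub|] := boolP (N \subset visited); first by exists M; constructor.
  case/subsetPn => v vN vv; have vNv : v \in N :\: visited by rewrite in_setD vv.
  have [|M' run] := IHn (v |: visited) [:: v] M; first exact: leq_trans (vsub v vNv) le.
  by exists M'; exact: dfs_start run.
have [/existsP [w /existsP [a adv]]|no] := boolP [exists w, exists a, advances inc N A
  visited v w a].
  have [|M' run] := IHn (w |: visited) [:: w, v & p] ((w, a) |: M).
    by have /and3P [wN _ _] := adv; exact: leq_trans (vsub w wN) le.
  by exists M'; exact: dfs_advance adv run.
have [M' run] := IHp M le; exists M'; apply: dfs_backtrack run => w a.
by apply: contra no => adv; apply/existsP; exists w; apply/existsP; exists a.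
Qed.

End DFS.

(** * The middle interfaces *)

Section Middle.
Variable V : finType.
Notation simplex := {set V}.
Notation edge := ({set V} * {set V})%type.
Variable d : nat.
Hypothesis d_gt0 : 0 < d.
Implicit Types (K H F W X S : {set simplex}) (E M U : {set edge}) (s t a b c : simplex).

Lemma simplicesP H i s : reflect (s \in H /\ #|s| = i.+1) (s \in simplices H i).
Proof. by apply: (iffP setIdP) => -[? /eqP]. Qed.

Lemma lower_simplicesP H s : reflect (s \in H /\ #|s| = d) (s \in simplices H d.-1).
Proof. by apply: (iffP (simplicesP _ _ _)); rewrite prednK. Qed.

Lemma interfaceP H s :
  reflect (s \in H /\ (#|s| = d.+1 \/ #|s| = d)) (s \in interface H d).
Proof.
apply: (iffP setUP) => [[/simplicesP [? ?]|/lower_simplicesP [? ?]]|[sH [sd|sd]]].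
- by split=> //; left.
- by split=> //; right.
- by left; apply/simplicesP.
- by right; apply/lower_simplicesP.
Qed.

Lemma interface_edge H a b : (a, b) \in edges (interface H d) ->
  [/\ a \in H, b \in H, #|a| = d, #|b| = d.+1 & facet a b].
Proof.
case/edgesP => /interfaceP [aH ad] /interfaceP [bH bd] f; have := facet_card f.
by split=> //; lia.
Qed.

Lemma facet_degreeE H s : #|s| = d.+1 ->
  facet_degree (interface H d) s = #|[set t in H | facet t s]|.
Proof.
move=> sd; rewrite /facet_degree; congr #|pred_of_set _|; apply/setP => t.
apply/setIdP/setIdP => -[tG f]; split=> //; first by case/interfaceP: tG.
by apply/interfaceP; split=> //; right; have := facet_card f; lia.
Qed.

(** * Matching the remaining (d-1)-simplices of a component *)

Section Extension.
Variables (H W : {set simplex}).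
Hypothesis WH : W \subset interface H d.

(** A closed V-path through [s] would enter it through [a] from another cofacet of [a]; that cofacet
    would be matched, but [a] has no matched cofacet. *)
Lemma extendable_acyclic M a s : matching (edges W) M -> acyclic M ->
  extendable W d M a s ->
  matching (edges W) ((a, s) |: M) /\ acyclic ((a, s) |: M).
Proof.
move=> mM aM /and4P[/lower_simplicesP [aW ad] aM' /eqP cof]; rewrite inE => /andP[sW fas].
have sM : s \notin regular M.
  apply/negP => sM; have := in_set0 s; rewrite -cof in_setI sM andbT => /negP; apply.
  by rewrite inE sW.
split.
  apply: matchingU => //; first by apply: matching1; apply/edgesP.
  rewrite disjoints_subset; apply/subsetP => u /regularP [e /set1P ->].
  by rewrite !inE => /orP[] /eqP ->.
move=> X bX; have sX : s \notin X.
  apply/negP => sX; have [u uX /leadP [b [bs bu us]]] := bX s sX.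
  have ba : b = a.
    by case/setU1P: bs => [[]//|/regular_snd]; rewrite (negbTE sM).
  have [v _ /leadP [c [cu _ _]]] := bX u uX.
  have cuM : (c, u) \in M by case/setU1P: cu => // -[_ e]; rewrite e eqxx in us.
  have := in_set0 u; rewrite -cof in_setI (regular_snd cuM) andbT inE -ba bu andbT.
  by have /matchingP [/subsetP /(_ _ cuM) /edgesP [_ -> _]] := mM.
apply: aM => t tX; have [u uX /leadP [b [bt bu ut]]] := bX t tX.
exists u => //; apply/leadP; exists b; split=> //.
by case/setU1P: bt => // -[_ e]; rewrite -e tX in sX.
Qed.

(** The last clause is what the second step of [intermediate_apx] achieves: an unmatched
    (d-1)-simplex without a matched cofacet could still be extended. *)
Lemma extension_spec M M' : extension W d M M' -> matching (edges W) M -> acyclic M ->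
  [/\ matching (edges W) M', acyclic M' &
    forall t s, t \in W -> #|t| = d -> s \in W -> facet t s ->
    exists a b, (a, b) \in M' /\ facet t b].
Proof.
elim=> {M M'} [M no mM aM|M a s M' ext _ IH mM aM]; last first.
  by have [mM' aM'] := extendable_acyclic mM aM ext; exact: IH.
split=> // t s tW td sW fts.
have [tM|tM] := boolP (t \in regular M).
  case/regularP: tM => -[a b] abM; have abE := subsetP (proj1 (matchingP _ _ mM)) _ abM.
  have [_ _ ad bd fab] := interface_edge (subsetP (edges_sub WH) _ abE).
  rewrite !inE => /orP[] /eqP /= te; last by move: td; rewrite te bd; lia.
  by exists a, b; rewrite te.
have [cof|/set0Pn [b /setIP [/setIdP [bW ftb] bM]]] :=
  eqVneq (cofacets W t :&: regular M) set0.
  have := no t s; rewrite /extendable tM cof eqxx [s \in _]inE sW fts !andbT /=.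
  by move/negP; case; apply/lower_simplicesP.
case/regularP: bM => -[a c] acM; have acE := subsetP (proj1 (matchingP _ _ mM)) _ acM.
have [_ _ ad cd fac] := interface_edge (subsetP (edges_sub WH) _ acE).
have bd := facet_card ftb.
rewrite !inE => /orP[] /eqP /= be; first by move: bd; rewrite be; lia.
by exists a, c; rewrite -be in acM *.
Qed.

Lemma extension_exists M : exists M', extension W d M M'.
Proof.
have [n] := ubnP #|W :\: regular M|; elim: n => // n IH in M * => le_n.
have [/existsP [t /existsP [s ext]]|no] := boolP [exists t, exists s, extendable W d M t s].
  have [|M' run] := IH ((t, s) |: M); last by exists M'; exact: extension_step ext run.
  rewrite ltnS in le_n; apply: leq_trans le_n; apply: proper_card; apply/properP.
  have /and4P [/lower_simplicesP [tW _] tM _ _] := ext.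
  split; first by apply: setDS; rewrite regularU subsetUr.
  exists t; first by rewrite in_setD tM.
  by rewrite in_setD tW andbT negbK regularU in_setU (@regular_fst _ [set (t, s)] t s) ?inE.
exists M; constructor => t s; apply: contra no => ext.
by apply/existsP; exists t; apply/existsP; exists s.
Qed.

End Extension.

Lemma intermediate_apx_spec H W M : W \subset interface H d -> intermediate_apx W d M ->
  [/\ matching (edges W) M, acyclic M &
    forall t s, t \in W -> #|t| = d -> s \in W -> facet t s ->
    exists a b, (a, b) \in M /\ facet t b].
Proof. by move=> WH [M0 /frontier_acyclic [mM0 aM0] /(extension_spec WH)]; exact. Qed.

Lemma intermediate_apx_exists W : exists M, intermediate_apx W d M.
Proof.
have [M0 fr] := frontier_exists W; have [M ext] := extension_exists W M0.
by exists M; exists M0.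
Qed.

Lemma min_facet_componentP H F : min_facet_component (interface H d) d F ->
  [/\ F \subset interface H d,
      exists2 t, t \in F & #|t| = d,
      forall t, t \in F -> #|t| = d -> exists2 s, s \in F & facet t s,
      forall s t, s \in F -> #|s| = d.+1 -> t \in H -> facet t s -> t \in F &
      forall s s', s \in F -> #|s| = d.+1 -> s' \in H -> #|s'| = d.+1 ->
        0 < facet_degree (interface H d) s' ->
        facet_degree (interface H d) s <= facet_degree (interface H d) s'].
Proof.
case=> S /maxsetP [/andP[/subsetP Smin conn] _] ->.
have SP s : s \in S -> [/\ s \in H, #|s| = d.+1, 0 < facet_degree (interface H d) s &
    forall s', s' \in H -> #|s'| = d.+1 -> 0 < facet_degree (interface H d) s' ->
        facet_degree (interface H d) s <= facet_degree (interface H d) s'].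
  move=> /Smin /setIdP [/simplicesP [/interfaceP [sH _] sd] /andP[deg /forallP min]].
  split=> // s' s'H s'd deg'; have /implyP h := min s'.
  have /h : s' \in simplices (interface H d) d.
    by apply/simplicesP; split=> //; apply/interfaceP; split=> //; left.
  by rewrite deg'.
have hullP t : t \in facet_hull (interface H d) S ->
    t \in S \/ (t \in H /\ #|t| = d) /\ exists2 s, s \in S & facet t s.
  case/setUP => [|/setIdP [/interfaceP [tH td] /existsP [s /andP[sS f]]]]; first by left.
  right; split; last by exists s.
  by have [_ sd _ _] := SP s sS; have := facet_card f; split=> //; lia.
have inS s : s \in facet_hull (interface H d) S -> #|s| = d.+1 -> s \in S.
  by case/hullP => // -[[_ sd] _]; rewrite sd; lia.
have hullf s t : s \in S -> t \in H -> facet t s -> t \in facet_hull (interface H d) S.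
  move=> sS tH f; apply/setUP; right; apply/setIdP; split.
    apply/interfaceP; split=> //; right.
    by have [_ sd _ _] := SP s sS; have := facet_card f; lia.
  by apply/existsP; exists s; rewrite sS.
have [s sS] : exists s, s \in S.
  have /andP[/set0Pn [t /hullP [tS|[_ [s sS _]]]] _] := conn; [by exists t | by exists s].
split.
- apply/subsetP => t /hullP [/SP [tH td _ _]|[[tH td] _]]; apply/interfaceP; split=> //.
    by left.
  by right.
- have [_ sd + _] := SP s sS; rewrite facet_degreeE // => /card_gt0P [t /setIdP [tH f]].
  by exists t; [exact: hullf f | have := facet_card f; lia].
- move=> t /hullP [/SP [_ -> _ _]|[_ [u uS f]] _]; first by lia.
  by exists u => //; rewrite in_setU uS.
- by move=> u t uF ud tH f; apply: hullf f => //; exact: inS.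
- by move=> u u' uF ud; have [_ _ _] := SP u (inS u uF ud); exact.
Qed.

Lemma min_facet_component_exists H s : s \in H -> #|s| = d.+1 ->
    0 < facet_degree (interface H d) s ->
  exists F, min_facet_component (interface H d) d F.
Proof.
move=> sH sd deg; set G := interface H d.
pose Q s := (s \in simplices G d) && (0 < facet_degree G s).
have Qs : Q s.
  by rewrite /Q deg andbT; apply/simplicesP; split=> //; apply/interfaceP; split=> //; left.
case: (arg_minnP (facet_degree G) Qs) => m /andP[mG mdeg] mmin.
have mS : m \in min_facet_simplices G d.
  apply/setIdP; split=> //; rewrite mdeg; apply/forallP => u.
  by apply/implyP => uG; apply/implyP => udeg; apply: mmin; rewrite /Q uG.
have [S Smax _] : {S | maxset (fun S' : {set simplex} =>
  (S' \subset min_facet_simplices G d) &&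
                                      connected_subgraph (facet_hull G S')) S & [set m]
                                        \subset S}.
  apply: maxset_exists; rewrite sub1set mS /=.
  have mh : m \in facet_hull G [set m] by rewrite !inE eqxx.
  apply/andP; split; first by apply/set0Pn; exists m.
  have hP t : t \in facet_hull G [set m] -> t = m \/ facet t m.
    case/setUP => [/set1P|/setIdP [_ /existsP [u /andP[/set1P ->]]]]; [by left | by right].
  pose r := [rel u v | [&& u \in facet_hull G [set m], v \in facet_hull G [set m] & facet
    u v || facet v u]].
  have rm t : t \in facet_hull G [set m] -> connect r t m /\ connect r m t.
    move=> th; case: (hP t th) => [->|f]; first by rewrite connect0.
    by split; apply: connect1; rewrite /= th mh f ?orbT.
  apply/forallP => u; apply/implyP => /rm [um _]; apply/forallP => v; apply/implyP =>
    /rm [_ mv].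
  exact: connect_trans um mv.
by exists (facet_hull G S), S.
Qed.

Lemma delete_fromE H F M : delete_from H F d M = H :\: (regular M :|: simplices F d.-1).
Proof.
by apply/setP => s; rewrite !in_set; case: (s \in regular M).
Qed.

Lemma middle_interface_exists H U : exists H' U', middle_interface d H U H' U'.
Proof.
have [n] := ubnP #|H|; elim: n => // n IH in H U * => le_n.
have [/existsP [s /andP[/simplicesP [sH sd] deg]]|no] :=
    boolP [exists s, (s \in simplices H d) && (0 < facet_degree (interface H d) s)];
      last first.
  exists H, U; constructor => s sH; apply/eqP; apply: contraR no => deg.
  by apply/existsP; exists s; rewrite sH lt0n.
have [F Fmin] := min_facet_component_exists sH sd deg.
have [M apx] := intermediate_apx_exists F.
have [/subsetP FG [t tF td] _ _ _] := min_facet_componentP Fmin.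
have [|H' [U' run]] := IH (delete_from H F d M) (U :|: M).
  rewrite ltnS in le_n; apply: leq_trans le_n; apply: proper_card; apply/properP; split;
    first exact: subsetDl.
  exists t; first by case/interfaceP: (FG t tF).
  rewrite delete_fromE in_setD negb_and negbK in_setU; apply/orP; left; apply/orP; right.
  exact/lower_simplicesP.
by exists H', U'; exact: middle_step Fmin apx run.
Qed.

Lemma leq_card_bigcup (T I : finType) (P : {pred I}) (f : I -> {set T}) k :
  (forall i, i \in P -> #|f i| <= k) -> #|\bigcup_(i in P) f i| <= #|P| * k.
Proof.
move=> le; apply: (@leq_trans (\sum_(i in P) k)); last by rewrite sum_nat_const.
apply: (@leq_trans (\sum_(i in P) #|f i|)); last exact: leq_sum.
elim/big_rec2: _ => [|i m A _ le']; first by rewrite cards0.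
by apply: leq_trans (leq_card_setU _ _).1 _; rewrite leq_add2l.
Qed.

(** Read contrapositively: a surviving (d-1)-simplex keeps all its cofacets of [K]. This lets one
    pass from a [d]-simplex to its neighbours in [K] without leaving [H]. *)
Definition top_closed (K H : {set simplex}) :=
  forall s t, s \in K -> #|s| = d.+1 -> s \notin H -> t \in H -> ~~ facet t s.

(** Effect of any number of rounds on one interface, in a form that composes. [ms_facets] rules out
    V-paths from an earlier round into a later one, and [ms_count] is the counting inequality for
    the (d-1)-simplices deleted so far. *)
Record middle_spec H M H' : Prop := MiddleSpec {
  ms_matching : matching (edges (interface H d)) M;
  ms_acyclic : acyclic M;
  ms_sub : H' \subset H;
  ms_disjoint : [disjoint regular M & H'];
  ms_deleted : forall s, s \in H -> s \notin H' -> #|s| = d \/ exists a, (a, s) \in M;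
  ms_covered : forall t, t \in H -> t \notin H' -> #|t| = d ->
    exists a b, (a, b) \in M /\ facet t b;
  ms_facets : forall a b c, (a, b) \in M -> facet c b -> c \notin H';
  ms_count : #|[set t in H | #|t| == d] :\: H'| <= d * #|M| }.

(** All that the counting needs from topology. It ranges over every [H1] the rounds may reach, and
    the bound on one [d]-simplex bounds the facet degree in every min-facet component. *)
Definition small_degrees (K H : {set simplex}) :=
  forall H1 s, H1 \subset H -> top_closed K H1 -> s \in H1 -> #|s| = d.+1 ->
    0 < facet_degree (interface H1 d) s ->
  exists s', [/\ s' \in H1, #|s'| = d.+1, 0 < facet_degree (interface H1 d) s' &
                 facet_degree (interface H1 d) s' <= d].

Lemma interface_sub H H' : H' \subset H -> interface H' d \subset interface H d.
Proof.
move=> /subsetP sub; apply/subsetP => s /interfaceP [sH sd].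
by apply/interfaceP; split=> //; exact: sub.
Qed.

Lemma middle_spec_top_closed K H M H' : middle_spec H M H' ->
  top_closed K H -> top_closed K H'.
Proof.
move=> ms tcl s u sK sd sH' uH'.
have [sH|sH] := boolP (s \in H); last first.
  by apply: tcl sH (subsetP (ms_sub ms) _ uH').
case: (ms_deleted ms sH sH') => [|[a asM]]; first by lia.
by apply: contraL uH'; exact: ms_facets ms _ _ _ asM.
Qed.

Lemma middle_spec0 H : middle_spec H set0 H.
Proof.
split=> //.
- exact: matching0.
- exact: acyclic0.
- by rewrite disjoints_subset; apply/subsetP => s /regularP [e]; rewrite inE.
- by move=> s ->.
- by move=> s ->.
- by move=> a b c; rewrite inE.
- by rewrite cards0 muln0 leqn0 cards_eq0 setD_eq0; apply/subsetP => s /setIdP [].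
Qed.

Lemma middle_spec_trans H M H1 M' H' :
  middle_spec H M H1 -> middle_spec H1 M' H' -> middle_spec H (M :|: M') H'.
Proof.
move=> ms1 ms.
have M'H1 : regular M' \subset H1.
  have := regular_edges (proj1 (matchingP _ _ (ms_matching ms))).
  by move/subset_trans; apply; apply/subsetP => s /interfaceP [].
have dMM' : [disjoint regular M & regular M'] by exact: disjointWr M'H1 (ms_disjoint ms1).
have H'H1 := ms_sub ms; have H1H := ms_sub ms1.
split.
- apply: matchingU dMM' => //; first exact: ms_matching ms1.
  apply: matching_subset (ms_matching ms) _.
  apply: subset_trans (edges_sub (interface_sub H1H)).
  by have /matchingP [] := ms_matching ms.
- apply: acyclicU dMM' _ => //; [exact: ms_acyclic ms1 | exact: ms_acyclic ms |].
  move=> a b c e abM /regular_fst cM'; apply: contraL (subsetP M'H1 _ cM').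
  exact: ms_facets ms1 _ _ _ abM.
- exact: subset_trans H1H.
- rewrite regularU disjoints_subset subUset -!disjoints_subset (ms_disjoint ms) andbT.
  exact: disjointWr H'H1 (ms_disjoint ms1).
- move=> s sH sH'; have [sH1|sH1] := boolP (s \in H1).
    by case: (ms_deleted ms sH1 sH') => [|[a aM']]; [left | right; exists a;
      rewrite inE aM' orbT].
  by case: (ms_deleted ms1 sH sH1) => [|[a aM']]; [left | right; exists a; rewrite inE aM'].
- move=> s sH sH' sd; have [sH1|sH1] := boolP (s \in H1).
    by have [a [b [abM f]]] := ms_covered ms sH1 sH' sd; exists a, b; rewrite inE abM orbT.
  by have [a [b [abM f]]] := ms_covered ms1 sH sH1 sd; exists a, b; rewrite inE abM.
- move=> a b c /setUP [abM|abM] f; last exact: ms_facets ms _ _ _ abM f.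
  by apply: contra (ms_facets ms1 abM f); exact: (subsetP H'H1).
have MM'0 : M :&: M' = set0.
  apply/setP => -[a b]; rewrite !inE; apply/andP => -[/regular_fst aM' /regular_fst].
  by rewrite (disjointFr dMM' aM').
rewrite cardsU MM'0 cards0 subn0 mulnDr.
apply: leq_trans (leq_add (ms_count ms1) (ms_count ms)).
apply: leq_trans (leq_card_setU _ _).1.
apply: subset_leq_card; apply/subsetP => s /setDP [sH sH'].
have /setIdP [sH0 sd] := sH.
have [sH1|sH1] := boolP (s \in H1); last by rewrite in_setU in_setD sH1 sH.
by apply/setUP; right; rewrite in_setD sH'; apply/setIdP.
Qed.

Lemma middle_step_spec K H F M : H \subset K -> top_closed K H -> small_degrees K H ->
    min_facet_component (interface H d) d F -> intermediate_apx F d M ->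
  middle_spec H M (delete_from H F d M).
Proof.
move=> HK tcl small Fmin apx.
have [FG [t tF td] Fcof Fcl Fdeg] := min_facet_componentP Fmin.
have [mM aM cov] := intermediate_apx_spec FG apx.
have mG : matching (edges (interface H d)) M.
  apply: (matching_subset mM); apply: subset_trans (edges_sub FG).
  by have /matchingP [] := mM.
have ME a b : (a, b) \in M -> [/\ a \in F, b \in F, #|a| = d, #|b| = d.+1 & facet a b].
  move=> abM; have abE := subsetP (proj1 (matchingP _ _ mM)) _ abM.
  have [_ _ ad bd f] := interface_edge (subsetP (edges_sub FG) _ abE).
  by have /edgesP [] := abE.
have FH s : s \in F -> s \in H by move=> /(subsetP FG) /interfaceP [].
have delP s : s \in H -> s \notin delete_from H F d M ->
    (exists a, (a, s) \in M) \/ s \in F /\ #|s| = d.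
  move=> sH; rewrite delete_fromE in_setD sH andbT negbK =>
    /setUP [|/lower_simplicesP]; last by right.
  case/regularP => -[a b] abM; have [aF bF ad bd f] := ME a b abM.
  by rewrite !inE => /orP[] /eqP /= ->; [right | left; exists a].
have lowF s : s \in F -> #|s| = d -> s \notin delete_from H F d M.
  by move=> sF sd; rewrite delete_fromE in_setD in_setU negb_and negbK
    (introT (lower_simplicesP _ _) (conj sF sd)) orbT.
have facets a b c : (a, b) \in M -> facet c b -> c \notin delete_from H F d M.
  move=> abM f; have [_ bF _ bd _] := ME a b abM; apply/negP => cH'.
  have cH : c \in H by move: cH'; rewrite delete_fromE => /setDP [].
  have cF := Fcl b c bF bd cH f; move: cH'; apply/negP; apply: lowF => //.
  by have := facet_card f; lia.
have sub : delete_from H F d M \subset H by exact: subsetDl.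
have covered s : s \in H -> s \notin delete_from H F d M -> #|s| = d ->
    exists a b, (a, b) \in M /\ facet s b.
  move=> sH /(delP s sH) [[a /ME [_ _ _ sd' _]] sd|[sF sd] _]; first by lia.
  by have [u uF f] := Fcof s sF sd; exact: cov f.
split=> //.
- by rewrite disjoints_subset delete_fromE; apply/subsetP => s sM; rewrite !inE sM.
- by move=> s sH /(delP s sH) [|[]]; [right | left].
have [u uF ftu] := Fcof t tF td.
have ud : #|u| = d.+1 by rewrite (facet_card ftu) td.
have degu : 0 < facet_degree (interface H d) u.
  by rewrite facet_degreeE //; apply/card_gt0P; exists t; apply/setIdP; split=> //;
    exact: FH.
have [u' [u'H u'd degu' small_u']] := small H u (subxx H) tcl (FH u uF) ud degu.
(* The deleted (d-1)-simplices are covered by the remaining facets of the matched [d]-simplices of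
   [F], each of which has the minimum facet degree, hence at most [d]. *)
pose f (e : edge) := [set c in H | facet c e.2].
have le : #|\bigcup_(e in M) f e| <= #|M| * d.
  apply: leq_card_bigcup => -[a b] /ME [_ bF _ bd _].
  rewrite -facet_degreeE //; apply: leq_trans small_u'; exact: Fdeg.
rewrite mulnC; apply: leq_trans le; apply: subset_leq_card; apply/subsetP => s.
move=> /setDP [/setIdP [sH /eqP sd] sH']; have [a [b [abM fsb]]] := covered s sH sH' sd.
by apply/bigcupP; exists (a, b) => //; apply/setIdP.
Qed.

Lemma middle_interface_spec K H U H' U' : middle_interface d H U H' U' ->
    H \subset K -> top_closed K H -> small_degrees K H ->
  [/\ exists2 M, U' = U :|: M & middle_spec H M H', top_closed K H' &
    forall s t, s \in H' -> #|s| = d.+1 -> t \in H' -> ~~ facet t s].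
Proof.
elim=> {H U H' U'} [H U stop|H U F M H' U' Fmin apx _ IH] HK tcl small.
  split=> //; first by exists set0; [rewrite setU0 | exact: middle_spec0].
  move=> s t sH sd tH; apply/negP => f.
  have /eqP := stop s (introT (simplicesP _ _ _) (conj sH sd)).
  by rewrite facet_degreeE // cards_eq0 => /eqP /setP /(_ t); rewrite !inE tH f.
have ms1 := middle_step_spec HK tcl small Fmin apx.
have tcl1 := middle_spec_top_closed ms1 tcl.
have [||[M' -> ms] tcl' stop] := IH _ tcl1; first exact: subset_trans (ms_sub ms1) HK.
  by move=> H2 s H2H1; apply: small; exact: subset_trans (ms_sub ms1).
split=> //; exists (M :|: M'); first by rewrite setUA.
exact: middle_spec_trans ms.
Qed.

End Middle.

(** * Facets *)

Section Facets.
Variable V : finType.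
Implicit Types (s t a b c : {set V}) (v w u : V).

Lemma facet_sub t s : facet t s -> t \subset s.
Proof. by case/andP. Qed.

Lemma facetD1 s v : v \in s -> facet (s :\ v) s.
Proof. by move=> vs; rewrite /facet subD1set (cardsD1 v s) vs eqxx. Qed.

Lemma facetU1 s v : v \notin s -> facet s (v |: s).
Proof. by move=> vs; rewrite /facet subsetUr cardsU1 vs eqxx. Qed.

Lemma facetP t s : facet t s -> exists2 v, v \in s & t = s :\ v.
Proof.
case/andP => ts /eqP c; have /cards1P [v vE] : #|s :\: t| == 1.
  by apply/eqP; have := cardsID t s; rewrite (setIidPr ts) c; lia.
have /setDP [vs vt] : v \in s :\: t by rewrite vE set11.
exists v => //; apply/eqP; rewrite eqEcard subsetD1 ts vt /=.
by have := cardsD1 v s; rewrite vs c; lia.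
Qed.

Lemma facet_setU1P t s : facet t s -> exists2 v, v \notin t & s = v |: t.
Proof.
case/facetP => v vs ->; exists v; first by rewrite !inE eqxx.
by rewrite setD1K.
Qed.

Lemma card_facets s : #|[set t | facet t s]| = #|s|.
Proof.
rewrite -(_ : [set s :\ v | v in s] = [set t | facet t s]).
  rewrite card_in_imset // => v w vs ws e.
  have : v \notin s :\ w by rewrite -e !inE eqxx.
  by rewrite !inE vs andbT negbK => /eqP.
apply/setP => t; rewrite inE; apply/imsetP/idP =>
  [[v vs ->]|/facetP [v]]; first exact: facetD1.
by exists v.
Qed.

Lemma card_between a b : a \subset b -> #|b| = #|a|.+2 ->
  #|[set t | facet a t && facet t b]| = 2.
Proof.
move=> ab cb; have c2 : #|b :\: a| = 2 by have := cardsID a b; rewrite (setIidPr ab) cb;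
  lia.
rewrite -(_ : [set v |: a | v in b :\: a] = [set t | facet a t && facet t b]).
  rewrite card_in_imset // => v w /setDP [_ va] /setDP [_ wa] e.
  have : v \in w |: a by rewrite -e setU11.
  by rewrite in_setU1 (negbTE va) orbF => /eqP.
apply/setP => t; rewrite inE; apply/imsetP/andP =>
  [[v /setDP [vb va] ->]|[/facet_setU1P [v va ->] /facet_sub tb]].
  rewrite facetU1 //; split=> //; rewrite /facet subUset sub1set vb ab /=.
  by rewrite cardsU1 va cb.
by exists v => //; rewrite in_setD va (subsetP tb) ?setU11.
Qed.

Lemma other_between a t b : facet a t -> facet t b ->
  exists t', [/\ facet a t', facet t' b & t' != t].
Proof.
move=> fat ftb; have := @card_between a b (subset_trans (facet_sub fat) (facet_sub ftb)).
rewrite (facet_card ftb) (facet_card fat) => /(_ erefl) c2.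
have : t \in [set t | facet a t && facet t b] by rewrite inE fat.
move=> tS; have /cards1P [t' tE] : #|[set t | facet a t && facet t b] :\ t| == 1.
  by apply/eqP; have := cardsD1 t [set t | facet a t && facet t b]; rewrite tS c2; lia.
have /setD1P [ne] : t' \in [set t | facet a t && facet t b] :\ t by rewrite tE set11.
by rewrite inE => /andP[? ?]; exists t'.
Qed.

(* Otherwise the facets of s would form a cycle of V-paths. *)
Lemma facet_not_top (M : {set {set V} * {set V}}) s : 0 < #|s| -> acyclic M ->
    (forall a b, (a, b) \in M -> facet a b) ->
  exists2 t, facet t s & forall a, (a, t) \notin M.
Proof.
move=> s0 aM Mf.
have [/existsP [t /andP[f /forallP no]]|all] :=
  boolP [exists t, facet t s && [forall a, (a, t) \notin M]].
  by exists t.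
have e0 : [set t | facet t s] = set0.
  apply: aM => t; rewrite inE => f; move: all; rewrite negb_exists => /forallP /(_ t).
  rewrite f /= negb_forall => /existsP [a]; rewrite negbK => atM.
  have [t' [fat' ft's ne]] := other_between (Mf _ _ atM) f.
  by exists t'; [rewrite inE | apply/leadP; exists a].
by move: s0; rewrite -card_facets e0 cards0.
Qed.

End Facets.

(** * Strong connectivity of manifolds *)

Section Connectivity.
Variables (R : realType) (V : finType) (K : {set {set V}}) (D : nat).
Hypothesis manK : simplicial_manifold R K D.
Implicit Types (s t a b c x y : {set V}) (u v w : V) (B H : {set {set V}}).

Lemma simplex_extend s n : s \in K -> #|s| <= n <= D.+1 ->
  exists s', [/\ s' \in K, s \subset s' & #|s'| = n].
Proof.
move=> sK /andP[sn nD]; have [k] := ubnP (n - #|s|).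
elim: k => // k IH in s sK sn *; move=> le.
have [e|ne] := eqVneq #|s| n; first by exists s.
have [|v vs vK] := manifold_pure manK sK; first by lia.
have c : #|v |: s| = #|s|.+1 by rewrite cardsU1 vs.
have [||s' [s'K sub s'n]] := IH _ vK; try by rewrite c; lia.
by exists s'; split=> //; apply: subset_trans sub; exact: subsetUr.
Qed.

Definition facet_closed n B := forall s s' t, s \in B -> s' \in K -> #|s'| = n.+1 ->
  facet t s -> facet t s' -> s' \in B.

(** Induction on the codimension of [a]: by the induction hypothesis each vertex of the link of [a]
    has either all or none of the simplices around it in [B], and the choice is constant since the
    link is connected. *)
Lemma facet_closed_local n B : n <= D -> 
    (forall s, s \in B -> s \in K /\ #|s| = n.+1) -> facet_closed n B ->
  forall a s s', a \in K -> a \subset s -> s \in B -> a \subset s' -> s' \in K ->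
    #|s'| = n.+1 -> s' \in B.
Proof.
move=> nD BK clB a; have [k] := ubnP (n.+1 - #|a|); elim: k => // k IH in a *.
move=> le s s' aK as_ sB as' s'K s'n; have [sK sn] := BK s sB.
have [an|an] := ltnP n #|a|.
  have ea x : a \subset x -> #|x| = n.+1 -> a = x.
    by move=> ax xn; apply/eqP; rewrite eqEcard ax xn.
  by rewrite -(ea s') // (ea s).
have [e|an'] := eqVneq #|a| n.
  by apply: (clB s s' a) => //; rewrite /facet ?as_ ?as' ?sn ?s'n e eqxx.
have lt : #|a| < n by lia.
have out x : a \subset x -> #|x| = n.+1 -> exists2 v, v \in x & v \notin a.
  move=> ax xn; have /set0Pn [v /setDP []] : x :\: a != set0; last by exists v.
  by rewrite -card_gt0; have := cardsID a x; rewrite (setIidPr ax) xn; lia.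
have [v vs va] := out s as_ sn; have [w ws' wa] := out s' as' s'n.
have UK x u : x \in K -> a \subset x -> u \in x -> u |: a \in K.
  move=> xK ax ux; apply: (simplex_sub manK xK); first by rewrite subUset sub1set ux.
  by apply/set0Pn; exists u; rewrite setU11.
have cU u : u \notin a -> #|u |: a| = #|a|.+1 by move=> ua; rewrite cardsU1 ua.
pose X := [set u | (u \notin a) && [forall x in K, (u |: a \subset x) && (#|x| == n.+1)
  ==> (x \in B)]].
have XP u : u \in X -> forall x, x \in K -> u |: a \subset x -> #|x| = n.+1 -> x \in B.
  by rewrite inE => /andP[_ /forallP h] x xK ux xn; have := h x; rewrite xK ux xn eqxx.
have inX u x : u \notin a -> u |: a \subset x -> x \in B -> u \in X.
  move=> ua ux xB; rewrite inE ua; apply/forallP => y; apply/implyP => yK.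
  have [xK xn] := BK x xB.
  apply/implyP => /andP[uy /eqP yn]; apply: (IH (u |: a) _ x y) => //.
    rewrite (cU u ua) subSS; clear -le lt; lia.
  apply: (UK x) => //; first by apply: subset_trans ux; exact: subsetUr.
  by rewrite (subsetP ux) ?setU11.
have vX : v \in X by apply: (inX v s) => //; rewrite subUset sub1set vs.
have wX : w \in X.
  apply: (manifold_link_connected manK aK _ _ va _ wa _ vX); first by lia.
  - move=> u u' uX u'a uu'K; have [|x [xK ux xn]] := simplex_extend uu'K (n := n.+1).
      have := leq_card_setU [set u] (u' |: a); rewrite cU // cards1 => -[le' _].
      by rewrite ltnS nD andbT; apply: leq_trans le' _; rewrite add1n !ltnS.
    apply: (inX u' x u'a); first by apply: subset_trans ux; exact: subsetUr.
    by apply: (XP u uX) => //; apply: subset_trans ux; apply: setUS; exact: subsetUr.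
  - exact: UK s v sK as_ vs.
  - exact: UK s' w s'K as' ws'.
by apply: (XP w wX) => //; rewrite subUset sub1set ws'.
Qed.

Definition edge_rel : rel V := [rel v w | [set v; w] \in K].

Lemma simplex_vertex s v : s \in K -> v \in s -> [set v] \in K.
Proof.
move=> sK vs; apply: (simplex_sub manK sK); first by rewrite sub1set.
by apply/set0Pn; exists v; rewrite set11.
Qed.

Lemma simplex_edge s v w : s \in K -> v \in s -> w \in s -> edge_rel v w.
Proof.
move=> sK vs ws; apply: (simplex_sub manK sK); first by rewrite subUset !sub1set vs.
by apply/set0Pn; exists v; rewrite !inE eqxx.
Qed.

(** Along a path of edges, an [n]-simplex through each edge carries membership in [B] from the star
    of one vertex to the star of the next. *)
Lemma facet_closed_component n B : 0 < n <= D ->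
    (forall s, s \in B -> s \in K /\ #|s| = n.+1) -> facet_closed n B ->
  forall v w s s', connect edge_rel v w -> s \in B -> v \in s -> w \in s' ->
    s' \in K -> #|s'| = n.+1 -> s' \in B.
Proof.
move=> /andP[n0 nD] BK clB v w s s' /connectP [p]; elim: p v s => [|u p IH] v s /=.
  move=> _ -> sB vs vs' s'K s'n; apply: (facet_closed_local nD BK clB (a :=
    [set v]) (s := s)); rewrite ?sub1set //.
  exact: simplex_vertex s'K vs'.
move=> /andP[vu up] e sB vs; have [|x [xK ux xn]] := simplex_extend vu (n := n.+1).
  by rewrite cards2; case: (v != u); lia.
have ux' : u \in x by rewrite (subsetP ux) // !inE eqxx orbT.
apply: (IH u x) => //.
apply: (facet_closed_local nD BK clB (a := [set v]) (s := s)); rewrite ?sub1set //.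
  by have [sK _] := BK s sB; exact: simplex_vertex sK vs.
by rewrite (subsetP ux) // !inE eqxx.
Qed.

(* H has lost a simplex of dimension n - 1 in every component of K. *)
Definition missing n H := forall v, [set v] \in K ->
  exists w t, [/\ connect edge_rel v w, w \in t, t \in K, #|t| = n & t \notin H].

(** Otherwise the [n]-simplices with all facets in [H1] are closed under adjacency by [top_closed],
    hence fill a component, including a simplex around the missing [t]. *)
Lemma missing_small_degrees n H : 0 < n <= D -> H \subset K -> missing n H ->
  small_degrees n K H.
Proof.
move=> nD HK mis H1 s H1H tcl sH1 sn deg; have [n0 n1] := andP nD.
have H1K := subset_trans H1H HK.
have [/existsP [s' /and4P [s'H1 /eqP s'n deg' le]]|no] := boolP [exists s', [&& s' \in H1,
    #|s'| == n.+1, 0 < facet_degree (interface H1 n) s' & facet_degree (interface H1 n)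
      s' <= n]].
  by exists s'.
have full x : x \in H1 -> #|x| = n.+1 -> 0 < facet_degree (interface H1 n) x ->
    forall t, facet t x -> t \in H1.
  move=> xH xn dx t ftx; move: no; rewrite negb_exists => /forallP /(_ x).
  rewrite xH xn eqxx dx /= -ltnNge facet_degreeE // => lt.
  have : [set t in H1 | facet t x] == [set t | facet t x].
    rewrite eqEcard card_facets xn lt andbT; apply/subsetP => y; rewrite !inE.
    by case/andP.
  by move/eqP/setP/(_ t); rewrite !inE ftx andbT.
pose B := [set x in K | (#|x| == n.+1) && [forall t, facet t x ==> (t \in H1)]].
have BP x : x \in B -> [/\ x \in K, #|x| = n.+1 & forall t, facet t x -> t \in H1].
  rewrite inE => /and3P[xK /eqP xn /forallP h]; split=> // t f; exact: implyP (h t) f.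
have inB x : x \in H1 -> #|x| = n.+1 -> 0 < facet_degree (interface H1 n) x -> x \in B.
  move=> xH xn dx; rewrite inE (subsetP H1K) // xn eqxx; apply/forallP => t.
  by apply/implyP; exact: full.
have BK x : x \in B -> x \in K /\ #|x| = n.+1 by case/BP.
have clB : facet_closed n B.
  move=> x x' t xB x'K x'n ftx ftx'; have [_ _ /(_ t ftx) tH1] := BP x xB.
  have x'H1 : x' \in H1 by apply: contraT =>
    x'H1; have := tcl x' t x'K x'n x'H1 tH1; rewrite ftx'.
  apply: inB => //; rewrite facet_degreeE //; apply/card_gt0P; exists t.
  by rewrite inE tH1.
have sB := inB s sH1 sn deg.
have sK := subsetP H1K _ sH1.
have [v vs] : exists v, v \in s by apply/set0Pn; rewrite -card_gt0 sn.
have [w [t [vw wt tK tn tH]]] := mis v (simplex_vertex sK vs).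
have [|x [xK tx xn]] := simplex_extend tK (n := n.+1); first by rewrite tn leqnSn ltnS n1.
have xB := facet_closed_component nD BK clB vw sB vs (subsetP tx _ wt) xK xn.
have [_ _ /(_ t)] := BP x xB; rewrite /facet tx tn xn eqxx => /(_ isT) tH1.
by rewrite (subsetP H1H) in tH.
Qed.

End Connectivity.

(** * Invariants between two interfaces *)

Section Stages.
Variables (R : realType) (V : finType) (K : {set {set V}}) (D : nat).
Hypothesis manK : simplicial_manifold R K D.
Implicit Types (s t a b c x y : {set V}) (u v w : V) (B H : {set {set V}}).
Implicit Types (M U : {set {set V} * {set V}}).

(* The pairs between dimensions i - 1 and i: #|s| is the dimension plus one. *)
Definition level M i := #|[set e in M | #|e.2| == i.+1]|.

Lemma level_mono M M' i : M \subset M' -> level M i <= level M' i.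
Proof.
move=> /subsetP sub; apply: subset_leq_card; apply/subsetP => e /setIdP [/sub eM' ei].
exact/setIdP.
Qed.

(** The state before the [n]-interface. By [st_level] an (n-1)-simplex has disappeared only by being
    matched downwards, so it is already counted in [level U n.-1]. *)
Record stage n H U : Prop := Stage {
  st_sub : H \subset K;
  st_matching : matching (edges K) U;
  st_acyclic : acyclic U;
  st_disjoint : [disjoint regular U & H];
  st_tops : forall a b, (a, b) \in U -> #|b| <= n;
  st_upper : forall s, s \in K -> n < #|s| -> s \in H;
  st_level : forall s, s \in K -> #|s| = n -> s \notin H -> exists a, (a, s) \in U;
  st_missing : missing K n H;
  st_count : forall i, 1 < i < n ->
    #|simplices K i.-1| <= i * level U i + level U i.-1 }.

Lemma stage_next n H U H' U' : 1 < n < D -> stage n H U -> middle_interface n H U H' U' ->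
  stage n.+1 H' U' /\ U \subset U'.
Proof.
move=> /andP[n1 nD] st; have n0 : 0 < n by exact: ltnW.
have nD' : 0 < n <= D by rewrite n0 ltnW.
have HK := st_sub st.
have tcl : top_closed n K H by move=> s t sK sn; rewrite (st_upper st sK) // sn.
move/(middle_interface_spec n0)/(_ HK tcl (missing_small_degrees manK nD' HK (st_missing
  st))).
case=> [[M -> ms] tcl' stop].
have H'H := ms_sub ms.
have ME a b : (a, b) \in M -> [/\ a \in H, b \in H, #|a| = n, #|b| = n.+1 & facet a b].
  by move=> abM; apply: (interface_edge n0);
    have /matchingP [/subsetP /(_ _ abM)] := ms_matching ms.
have MH : regular M \subset H.
  by apply/subsetP => s /regularP [[a b] /ME [aH bH _ _ _]]; rewrite !inE => /orP[] /eqP ->.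
have dUM : [disjoint regular U & regular M] by exact: disjointWr MH (st_disjoint st).
(* Since [K] is pure, no (n-1)-simplex survives the [n]-interface. *)
have gone s t : s \in K -> #|s| = n.+1 -> facet t s -> t \notin H'.
  move=> sK sn f; apply/negP => tH'; have [sH'|sH'] := boolP (s \in H').
    by have := stop s t sH' sn tH'; rewrite f.
  by have := tcl' s t sK sn sH' tH'; rewrite f.
split; last exact: subsetUl.
split.
- exact: subset_trans HK.
- apply: (matchingU (st_matching st) _ dUM); apply: (matching_subset (ms_matching ms)).
  have /matchingP [ME' _] := ms_matching ms; apply: (subset_trans ME'); apply: edges_sub.
  by apply/subsetP => s /(interfaceP n0) [/(subsetP HK)].
- apply: (acyclicU (st_acyclic st) (ms_acyclic ms) dUM) =>
    a b c e /(st_tops st) bn /ME [_ _ cn _ _].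
  by apply/negP => /facet_card bc; rewrite bc cn ltnn in bn.
- rewrite regularU disjoints_subset subUset -!disjoints_subset (ms_disjoint ms) andbT.
  exact: disjointWr H'H (st_disjoint st).
- by move=> a b /setUP [/(st_tops st)/leqW|/ME [_ _ _ -> _]].
- move=> s sK sn; apply: contraT => sH'; have sH := st_upper st sK (ltnW sn).
  by case: (ms_deleted ms sH sH') sn => [->|[a /ME [_ _ _ -> _]]];
    rewrite ?ltnn // ltnNge leqnSn.
- move=> s sK sn sH'; have sH : s \in H by apply: (st_upper st sK); rewrite sn.
  case: (ms_deleted ms sH sH') => [e|[a aM]]; first by move: sn; rewrite e => /n_Sn.
  by exists a; rewrite inE aM orbT.
(* Some facet [t] of an [n]-simplex [s] around [v] was not matched downwards, so it is deleted in
   this interface. It then lies in a matched [n]-simplex [b], which is the missing simplex; a vertex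
   of [t] links it to [v] inside [s]. *)
- move=> v vK; have [|s [sK vs sn]] := simplex_extend manK vK (n := n.+1).
    by rewrite cards1 ltn0Sn ltnS ltnW.
  have [||t fts no] := @facet_not_top _ U s _ (st_acyclic st); first by rewrite sn.
    by move=> a b abU; have /matchingP [/subsetP /(_ _ abU) /edgesP [_ _ f] _] :=
      st_matching st.
  have tn : #|t| = n by apply/succn_inj; rewrite -(facet_card fts).
  have tK : t \in K.
    by apply: (simplex_sub manK sK (facet_sub fts)); rewrite -card_gt0 tn.
  have tH : t \in H.
    by apply: contraT => tH; have [a aU] := st_level st tK tn tH; have := no a; rewrite aU.
  have [a [b [abM ftb]]] := ms_covered ms tH (gone s t sK sn fts) tn.
  have [_ bH _ bn _] := ME a b abM.
  have [w wt] : exists w, w \in t by apply/set0Pn; rewrite -card_gt0 tn.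
  exists w, b; split.
  + apply: connect1; apply: (simplex_edge manK sK); first by rewrite (subsetP vs) ?set11.
    exact: subsetP (facet_sub fts) _ wt.
  + exact: subsetP (facet_sub ftb) _ wt.
  + exact: subsetP HK _ bH.
  + exact: bn.
  + by rewrite (disjointFr (ms_disjoint ms)) ?(regular_snd abM).
- move=> i /andP[i1 i_n]; have mU j := level_mono j (subsetUl U M).
  have mM j := level_mono j (subsetUr U M).
  have [lt|ge] := ltnP i n.
    apply: leq_trans (st_count st (introT andP (conj i1 lt))) _.
    by rewrite leq_add ?leq_mul.
  have -> : i = n by apply/eqP; rewrite eqn_leq ge -ltnS i_n.
  have levM : level M n = #|M|.
    by rewrite /level; congr #|pred_of_set _|; apply/setP => -[a b]; rewrite inE;
      apply: andb_idr => /ME [_ _ _ -> _].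
  apply: leq_trans (leq_add (leq_mul (leqnn n) (mM n)) (mU n.-1)).
  rewrite levM; apply: leq_trans (leq_add (ms_count ms) (leq_imset_card snd _)).
  apply: leq_trans (leq_card_setU _ _).1; apply: subset_leq_card.
  apply/subsetP => t /(lower_simplicesP n0) [tK tn].
  have [|s [sK ts sn]] := simplex_extend manK tK (n := n.+1);
    first by rewrite tn leqnSn ltnS ltnW.
  have f : facet t s by rewrite /facet ts tn sn eqxx.
  (* Either [t] is deleted in this interface and counted by [ms_count], or it is the top of an
     earlier pair. *)
  have [tH|tH] := boolP (t \in H).
    by rewrite in_setU in_setD (gone s t) // inE tH tn eqxx.
  have [a aU] := st_level st tK tn tH.
  apply/setUP; right; apply/imsetP; exists (a, t) => //.
  by rewrite inE aU /= tn prednK.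
Qed.

Lemma two_elements (T : finType) (A : {set T}) (x y z : T) :
  #|A| = 2 -> x \in A -> y \in A -> z \in A -> x != y -> z = x \/ z = y.
Proof.
move=> A2 xA yA zA xy; have : A == [set x; y].
  by rewrite eq_sym eqEcard A2 cards2 xy subUset !sub1set xA yA.
by move/eqP => AE; move: zA; rewrite AE !inE => /orP[] /eqP ->; [left|right].
Qed.

Lemma facet_vertex t s : facet t s -> #|s| = 2 -> exists2 v, t = [set v] & v \in s.
Proof.
move=> f s2; have /cards1P [v tE] : #|t| == 1 by have := facet_card f; rewrite s2 => -[<-].
by exists v; rewrite // (subsetP (facet_sub f)) // tE set11.
Qed.

Lemma vertex_facet v s : #|s| = 2 -> v \in s -> facet [set v] s.
Proof. by move=> s2 vs; rewrite /facet sub1set vs cards1 s2. Qed.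

Lemma other_vertex v s : #|s| = 2 -> exists2 w, w \in s & w != v.
Proof.
move=> s2; have /set0Pn [w /setD1P [wv ws]] : s :\ v != set0; last by exists w.
by rewrite -card_gt0; have := cardsD1 v s; rewrite s2; case: (v \in s); case: #|_|.
Qed.

Lemma first_two_ends a x y s : a \in simplices K 1 -> x \in simplices K 0 ->
  y \in simplices K 0 -> s \in simplices K 0 ->
  joins (@facet V) a x y -> facet s a -> s = x \/ s = y.
Proof.
move=> /simplicesP [aK a2] _ _ _ /and3P[xy xa ya] sa.
by apply: (@two_elements _ [set t | facet t a]); rewrite ?inE ?card_facets.
Qed.

Variable M1 : {set {set V} * {set V}}.

Notation vertex_adjacent := (adjacent (@facet V) (simplices K 0) (simplices K 1)).

Lemma first_interface_spec : first_interface K M1 ->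
  exists R1, dfs_spec (@facet V) (simplices K 0) (simplices K 1) M1 R1.
Proof. by move/dfs_optimal_spec; apply; exact: first_two_ends. Qed.

Variable R1 : {set {set V}}.
Hypothesis spec1 : dfs_spec (@facet V) (simplices K 0) (simplices K 1) M1 R1.

Lemma first_pair a b : (a, b) \in M1 -> [/\ a \in K, #|a| = 1, b \in K, #|b| = 2 & facet
  a b].
Proof. by case/(dfs_pair spec1) => /simplicesP [? ?] _ /simplicesP [? ?] f. Qed.

Lemma first_matching : matching (edges K) M1.
Proof.
apply/matchingP; split.
  by apply/subsetP => -[w a] /first_pair [wK _ aK _ f]; apply/edgesP.
move=> [w a] [w' a'] waM wa'M ne; rewrite disjoints_subset; apply/subsetP => s.
have [_ w1 _ a2 _] := first_pair waM; have [_ w1' _ a2' _] := first_pair wa'M.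
rewrite !inE negb_or => /orP[] /eqP -> /=; apply/andP; split; apply/eqP => e.
- by move: waM ne; rewrite e => /(dfs_fst spec1)/(_ wa'M) ->; rewrite eqxx.
- by move: w1; rewrite e a2'.
- by move: a2; rewrite e w1'.
- by move: waM ne; rewrite e => /(dfs_snd spec1)/(_ wa'M) ->; rewrite eqxx.
Qed.

(** Here V-paths run towards the root, so the set handed to [dfs_acyclic] must be closed under
    successors instead of predecessors. *)
Lemma first_acyclic : acyclic M1.
Proof.
move=> X bX; apply/eqP; apply: contraT => X0.
have [|Y [Y0 YX fY]] := @forward_back_closed _ [rel s t | lead M1 t s] X X0.
  by move=> s /bX [t tX ts]; exists t.
have e0 : [set x in M1 | x.2 \in Y] = set0.
  apply: (dfs_acyclic spec1); first by apply/subsetP => x /setIdP [].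
  move=> [w s] /setIdP [_ /= sY]; have [t tY /leadP [a [at1 as1 st]]] := fY s sY.
  exists (a, t); split=> //; first exact/setIdP.
  by apply: contraNneq st => -[_ ->].
have /set0Pn [s sY] := Y0.
have [t _ /leadP [a [asM _ _]]] := bX s (subsetP YX _ sY).
have : (a, s) \in [set x in M1 | x.2 \in Y] by apply/setIdP.
by rewrite e0 inE.
Qed.

Lemma edge_adjacent v w s : s \in K -> v \in s -> w \in s -> v != w ->
  vertex_adjacent [set v] [set w].
Proof.
move=> sK vs ws vw; apply/adjacentP; exists [set v; w].
have c2 : #|[set v; w]| = 2 by rewrite cards2 vw.
split.
- by apply/simplicesP; rewrite cards1 (simplex_vertex manK sK).
- by apply/simplicesP; rewrite cards1 (simplex_vertex manK sK).
- by apply/simplicesP; split=> //; exact: (simplex_edge manK sK).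
- by rewrite /joins (inj_eq set1_inj) vw !vertex_facet ?inE ?eqxx ?orbT.
Qed.

Lemma first_root_unique s v w : s \in K -> v \in s -> w \in s ->
  [set v] \in R1 -> [set w] \in R1 -> v = w.
Proof.
move=> sK vs ws vR wR; have [//|vw] := eqVneq v w.
have := dfs_separated spec1 vR wR (connect1 (edge_adjacent sK vs ws vw)).
by move/set1_inj.
Qed.

Lemma first_stage : 1 <= D -> stage 2 (delete_from K K 1 M1) M1.
Proof.
move=> D1; have del s : (s \in delete_from K K 1 M1) = [&& s \notin regular M1, #|s| != 1
  & s \in K].
  rewrite delete_fromE in_setD in_setU negb_or -andbA; case: (s \in regular M1) => //=.
  by rewrite inE; case: (s \in K); rewrite ?andbF ?andbT.
split.
- exact: subsetDl.
- exact: first_matching.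
- exact: first_acyclic.
- by rewrite disjoints_subset; apply/subsetP => s sM; rewrite inE del sM.
- by move=> a b /first_pair [_ _ _ -> _].
- move=> s sK s2; rewrite del sK andbT; apply/andP; split; last by case: #|s| s2 => [|[]].
  apply/negP => /regularP [[a b] /first_pair [_ a1 _ b2 _]].
  by rewrite !inE => /orP[] /eqP /= e; move: s2; rewrite e ?a1 ?b2.
- move=> s sK s2; rewrite del sK s2 andbT /= andbT negbK => /regularP [[a b] abM].
  rewrite !inE => /orP[] /eqP /= e; last by exists a; rewrite e.
  by have [_ + _ _ _] := first_pair abM; rewrite -e s2.
(* A vertex that is not a root lies in its matched edge, which is missing; a root has a neighbour
   that is not a root. *)
- have cov v : [set v] \in K -> [set v] \notin R1 ->
      exists t, [/\ v \in t, t \in K, #|t| = 2 & t \notin delete_from K K 1 M1].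
    move=> vK vR; have [|a vaM] := dfs_cover spec1 _ vR; first by apply/simplicesP;
      rewrite cards1.
    have [_ _ aK a2 f] := first_pair vaM; exists a; split=> //.
      by rewrite -sub1set; exact: facet_sub f.
    by rewrite del (regular_snd vaM).
  move=> v vK; have [vR|/cov] := boolP ([set v] \in R1); last first.
    by case/(_ vK) => t [vt tK t2 tH]; exists v, t; split.
  have [|s [sK vs s2]] := simplex_extend manK vK (n := 2); first by rewrite cards1 ltnS.
  have [w ws wv] := other_vertex v s2.
  have vs' : v \in s by rewrite (subsetP vs) ?set11.
  have wR : [set w] \notin R1.
    by apply: contraNN wv => wR; apply/eqP; exact: first_root_unique sK ws vs' wR vR.
  have [t [wt tK t2 tH]] := cov w (simplex_vertex manK sK ws) wR.
  by exists w, t; split=> //; apply: connect1; exact: simplex_edge manK s v w sK vs' ws.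
- by case=> [|[|[]]].
Qed.

Lemma first_level : level M1 1 = #|M1|.
Proof.
rewrite /level; congr #|pred_of_set _|; apply/setP => -[a b]; rewrite inE.
by apply: andb_idr => /first_pair [_ _ _ -> _].
Qed.

End Stages.

Lemma double_count (S T : finType) (A : {set S}) (N : {set T}) (r : S -> T -> bool) :
  \sum_(a in A) #|[set x in N | r a x]| = \sum_(x in N) #|[set a in A | r a x]|.
Proof.
transitivity (\sum_(a in A) \sum_(x in N) (r a x : nat)).
  by apply: eq_bigr => a _; rewrite -sum1_card (eq_bigl _ _ (fun x =>
    in_set _ x)) big_mkcondr.
rewrite exchange_big; apply: eq_bigr => x _ /=.
by rewrite -sum1_card (eq_bigl _ _ (fun x => in_set _ x)) big_mkcondr.
Qed.

(** Serves to compare the roots of a search with the critical simplices of an arbitrary Morse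
    matching, one of which lies in each component. *)
Lemma separated_card (T : finType) (e : rel T) (A C : {set T}) : connect_sym e ->
    (forall x y, x \in A -> y \in A -> connect e x y -> x = y) ->
    (forall x, x \in A -> exists2 y, y \in C & connect e x y) ->
  #|A| <= #|C|.
Proof.
move=> sym sep AC; pose f x := odflt x [pick y in C | connect e x y].
have fP x : x \in A -> f x \in C /\ connect e x (f x).
  move=> /AC [y yC xy]; rewrite /f; case: pickP => [z /andP[]//|/(_ y)].
  by rewrite yC xy.
have inj : {in A &, injective f}.
  move=> x y xA yA fxy; apply: sep => //; have [_ xf] := fP x xA; have [_ yf] := fP y yA.
  by apply: connect_trans xf _; rewrite fxy sym.
rewrite -(card_in_imset inj); apply: subset_leq_card.
by apply/subsetP => y /imsetP [x xA ->]; case: (fP x xA).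
Qed.

(* The arithmetic of the approximation ratio: m i counts the pairs found in the
   i-interface, p i those of another matching, n i the i-simplices, and r the
   critical D-simplices. *)
Lemma approximation_arithmetic (m p n : nat -> nat) D r mD nD : 3 <= D ->
    (forall i, 1 < i < D -> n i.-1 <= i * m i + m i.-1) ->
    (forall i, 0 < i -> p i.-1 + p i <= n i.-1) ->
    p 1 <= m 1 -> p D + r <= nD -> nD = r + mD -> 2 * n D.-1 = D.+1 * nD ->
    D * r <= m 1 ->
  2 * (\sum_(1 <= i < D.+1) p i) <= D * (\sum_(1 <= i < D) m i + mD).
Proof.
move=> D3 hm hp p1 pD nDE nD1 r1.
(* The boundary terms make the sum telescope: the step amounts to
   [p k.-1 + p k <= D.-1 * m k + m k.-1], which follows from [hm] and [hp] as k is below [D]. At k =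
   2 both sides are equal. *)
have main k : 2 <= k <= D ->
    2 * (\sum_(1 <= i < k) p i) + D.-1 * m 1 + m k.-1 <=
    D * (\sum_(1 <= i < k) m i) + p 1 + p k.-1.
  elim: k => // -[_|k IH] // /andP[_ kD].
  case: k => [|k] in IH kD *; first by rewrite !big_nat1 /=; nia.
  rewrite big_nat_recr //= [X in _ <= D * X + _ + _]big_nat_recr //=.
  have {}IH := IH (ltnW kD); rewrite /= in IH.
  have h1 := hm k.+2 kD; have h2 := hp k.+2 (ltn0Sn _); rewrite /= in h1 h2.
  have : k.+2 * m k.+2 <= D.-1 * m k.+2 by rewrite leq_mul2r; apply/orP; right; lia.
  have -> : D = D.-1.+1 by lia.
  rewrite /= => h3; nia.
have {main} := main D; rewrite leqnn andbT => /(_ (ltnW D3)).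
have := hp D (ltnW (ltnW D3)).
rewrite big_nat_recr ?(leq_trans _ D3) //=.
move: (\sum_(1 <= i < D) p i) (\sum_(1 <= i < D) m i) => T S.
have : 3 * r <= m 1 by apply: leq_trans r1; rewrite leq_mul2r D3 orbT.
move: (m 1) (p 1) (p D) (p D.-1) (n D.-1) (m D.-1) p1 pD nDE nD1 => m1 p1 pD pD1 nD1 mD1.
(* After substituting [nD = r + mD], it suffices that (D+1) r + (D+3) mD is at most 2D mD + 2(D-2)
   m1. This holds since D >= 3 and 3r <= m1. *)
case: D D3 {hm hp r1} => [|[|[|d]]] //= _; nia.
Qed.

(** * Counting pairs by dimension *)

Section Levels.
Variables (V : finType) (K : {set {set V}}).
Hypothesis K0 : set0 \notin K.
Implicit Types (M : {set {set V} * {set V}}).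

(** An (i-1)-simplex cannot be both the top of one pair and the bottom of another. *)
Lemma level_adjacent M i : matching (edges K) M -> 0 < i ->
  level M i.-1 + level M i <= #|simplices K i.-1|.
Proof.
move=> mM i0; have ME a b : (a, b) \in M -> [/\ a \in K, b \in K & facet a b].
  by move=> abM; apply/edgesP; have /matchingP [/subsetP /(_ _ abM)] := mM.
pose A := [set e in M | #|e.2| == i.-1.+1]; pose B := [set e in M | #|e.2| == i.+1].
have injA : {in A &, injective snd}.
  move=> [a b] [c e] /setIdP [abM _] /setIdP [ceM _] /= be; subst e.
  by rewrite (matching_top mM abM ceM).
have injB : {in B &, injective fst}.
  move=> [a b] [c e] /setIdP [abM _] /setIdP [ceM _] /= ac; subst c.
  by rewrite (matching_bottom mM abM ceM).
have dis : (snd @: A) :&: (fst @: B) = set0.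
  apply/setP => t; rewrite !inE; apply/andP => -[/imsetP [[a b] /setIdP [abM _] /= ->]].
  by case/imsetP => -[c e] /setIdP [ceM _] /= bc; rewrite bc in abM;
    exact: matching_chain mM abM ceM.
rewrite /level -/A -/B -(card_in_imset injA) -(card_in_imset injB).
rewrite -cardsUI dis cards0 addn0; apply: subset_leq_card; apply/subsetP => t.
case/setUP => /imsetP [[a b] /setIdP [/ME [aK bK f] /eqP /= bi] ->] /=; apply/simplicesP;
  split=> //.
by rewrite prednK //; apply/succn_inj; rewrite -(facet_card f).
Qed.

Lemma card_levels M D : M \subset edges K -> (forall s, s \in K -> #|s| <= D.+1) ->
  #|M| = \sum_(1 <= i < D.+1) level M i.
Proof.
move=> /subsetP ME KD.
have MP e : e \in M -> 0 < #|e.2|.-1 < D.+1.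
  case: e => a b /ME /edgesP [aK bK f] /=; have := KD b bK; rewrite (facet_card f) /= => ->.
  by rewrite andbT card_gt0; apply: contraNneq K0 => <-.
rewrite -sum1_card.
transitivity (\sum_(e in M) \sum_(1 <= i < D.+1) (#|e.2| == i.+1 : nat)); last first.
  rewrite exchange_big /=; apply: eq_bigr => i _.
  by rewrite /level -sum1_card (eq_bigl _ _ (fun x => in_set _ x)) big_mkcondr.
apply: eq_bigr => e eM; have /andP[e0 eD] := MP e eM.
rewrite (bigD1_seq #|e.2|.-1) ?mem_index_iota ?e0 ?iota_uniq //= big1 => [|i].
  by case: #|e.2| e0 => //= k _; rewrite eqxx.
by case: (#|e.2| =P i.+1) => //= ->; rewrite eqxx.
Qed.

End Levels.

(** * The dual graph *)

Section Dual.
Variables (R : realType) (V : finType) (K : {set {set V}}) (D : nat).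
Hypothesis manK : simplicial_manifold R K D.
Hypothesis D_gt1 : 1 < D.
Implicit Types (s t a b c x y : {set V}) (v : V) (B H : {set {set V}}).
Implicit Types (M U : {set {set V} * {set V}}).

Lemma facet_top_simplex t s : s \in K -> #|s| = D.+1 -> facet t s ->
  [/\ t \in K, #|t| = D & #|cofacets K t| = 2].
Proof.
move=> sK sD f; have tD : #|t| = D by apply/succn_inj; rewrite -(facet_card f).
have tK : t \in K.
  by apply: (simplex_sub manK sK (facet_sub f)); rewrite -card_gt0 tD ltnW.
by split=> //; exact: (manifold_codim1 manK).
Qed.

Lemma mem_cofacets t s : (s \in cofacets K t) = (s \in K) && facet t s.
Proof. by rewrite inE. Qed.

(* The facets separating B from its complement are matched downwards; as an even
   number of them contains any given simplex of codimension 2, they would form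
   a cycle of V-paths. *)
Lemma unmatched_facet_closed U B : acyclic U -> matching (edges K) U ->
    (forall s, s \in B -> s \in K /\ #|s| = D.+1) ->
    (forall s s' t, s \in B -> s' \in K -> #|s'| = D.+1 -> facet t s -> facet t s' ->
       (forall a, (a, t) \notin U) -> s' \in B) ->
  facet_closed K D B.
Proof.
move=> aU mU BK clB.
pose N t := #|[set s in B | facet t s]|.
pose sep := [set t | N t == 1].
have BKs : B \subset K by apply/subsetP => s /BK [].
have Nle t : N t <= 2.
  have [->//|] := posnP (N t); case/card_gt0P => s /setIdP [sB f].
  have [sK sD] := BK s sB; have [_ _ <-] := facet_top_simplex sK sD f.
  by apply: subset_leq_card; apply/subsetP =>
    y /setIdP [/(subsetP BKs) yK yf]; rewrite mem_cofacets yK.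
have sepP t : N t = 1 -> exists s s', [/\ s \in B, s' \in K, facet t s, facet t s' & s'
  \notin B].
  move=> N1; have /card_gt0P [s /setIdP [sB f]] : 0 < N t by rewrite N1.
  have [sK sD] := BK s sB; have [_ _ c2] := facet_top_simplex sK sD f.
  have /subsetPn [s'] : ~~ (cofacets K t \subset [set s in B | facet t s]).
    by apply/negP => /subset_leq_card; rewrite c2 -/(N t) N1.
  rewrite mem_cofacets => /andP[s'K f']; rewrite inE f' andbT => s'B.
  by exists s, s'.
have sep0 : sep = set0.
  apply: aU => t; rewrite inE => /eqP Nt; have [s [s' [sB s'K f f' s'B]]] := sepP t Nt.
  have [sK sD] := BK s sB; have [tK tD _] := facet_top_simplex sK sD f.
  have s'D : #|s'| = D.+1 by rewrite (facet_card f') tD.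
  have [/existsP [a atU]|no] := boolP [exists a, (a, t) \in U]; last first.
    have := clB s s' t sB s'K s'D f f'; rewrite (negbTE s'B) => h; suff : false by [].
    by apply: h => a; apply: contra no => atU; apply/existsP; exists a.
  have fat : facet a t by have /matchingP [/subsetP /(_ _ atU) /edgesP []] := mU.
  have [/existsP [y /and3P[fay yt Ny]]|none] :=
    boolP [exists y, [&& facet a y, y != t & N y == 1]].
    by exists y; [rewrite inE | apply/leadP; exists a].
  (* A simplex of [B] containing [a] has exactly two facets around [a]. As [N t] is 1, another facet
     [y] around [a] has odd [N y], and this is 1 because of [Nle]. *)
  have even_sum : 2 %| \sum_(y in [set y | facet a y]) N y.
    rewrite double_count; apply: dvdn_sum => x xB; have [xK xD] := BK x xB.
    have [ax|ax] := boolP (a \subset x).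
      rewrite (_ : #|_| = 2) //; rewrite -(card_between ax).
        by congr #|pred_of_set _|; apply/setP => y; rewrite !inE.
      by rewrite xD -tD (facet_card fat).
    rewrite (_ : [set _ in _ | _] = set0) ?cards0 //; apply/setP => y; rewrite !inE.
    apply/andP => -[ay yx]; case/negP: ax.
    exact: subset_trans (facet_sub ay) (facet_sub yx).
  move: even_sum; rewrite (bigD1 t) ?inE //= Nt dvdn_addl //.
  apply: dvdn_sum => y; rewrite inE => /andP[ay yt].
  move: none; rewrite negb_exists => /forallP /(_ y); rewrite ay yt /=.
  by have := Nle y; case: (N y) => [|[|[]]].
move=> s s' t sB s'K s'D f f'; apply: contraT => s'B.
have : t \in sep; last by rewrite sep0 inE.
rewrite inE eqn_leq andbC card_gt0; apply/andP; split.
  by apply/set0Pn; exists s; rewrite inE sB.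
have [sK sD] := BK s sB; have [_ _ c2] := facet_top_simplex sK sD f.
rewrite -ltnS -c2; apply: proper_card; apply/properP; split.
  by apply/subsetP => y /setIdP [/(subsetP BKs) yK yf]; rewrite mem_cofacets yK.
by exists s'; rewrite ?mem_cofacets ?s'K // inE negb_and s'B.
Qed.

(** * The search on the dual graph and its optimality *)

Section LastInterface.
Variables (H : {set {set V}}) (U : {set {set V} * {set V}}).
Hypothesis st : stage K D H U.

Notation inc := [rel s t | facet t s].

Lemma top_simplices : simplices H D = simplices K D.
Proof.
apply/setP => s; apply/simplicesP/simplicesP => -[sH sD]; split=> //.
  exact: subsetP (st_sub st) _ sH.
by apply: (st_upper st sH); rewrite sD.
Qed.

Lemma top_simplexP s : s \in simplices H D -> s \in K /\ #|s| = D.+1.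
Proof. by rewrite top_simplices => /simplicesP. Qed.

Lemma last_two_ends a x y s : a \in simplices H D.-1 -> x \in simplices H D ->
  y \in simplices H D -> s \in simplices H D ->
  joins inc a x y -> inc s a -> s = x \/ s = y.
Proof.
move=> _ /top_simplexP [xK xD] /top_simplexP [yK _] /top_simplexP [sK _].
move=> /and3P[xy /= ax ay] sa; have [_ _ c2] := facet_top_simplex xK xD ax.
by apply: (two_elements c2); rewrite ?mem_cofacets ?xK ?yK ?sK.
Qed.

Variables (P : {set {set V} * {set V}}) (R2 : {set {set V}}).
Hypothesis spec2 : dfs_spec inc (simplices H D) (simplices H D.-1) P R2.

Notation dual_adjacent := (adjacent inc (simplices H D) (simplices H D.-1)).
Notation MD := [set (e.2, e.1) | e in P].

Lemma last_pairP a b : (a, b) \in MD -> (b, a) \in P /\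
  [/\ a \in H, #|a| = D, b \in H, #|b| = D.+1 & facet a b].
Proof.
case/imsetP => -[x y] xyP [-> ->]; split=> //.
by have [/simplicesP [? ?] _ /(lower_simplicesP (ltnW D_gt1)) [? ?] ?] :=
  dfs_pair spec2 xyP.
Qed.

Lemma last_matching : matching (edges K) MD.
Proof.
have HK := subsetP (st_sub st).
apply/matchingP; split.
  by apply/subsetP => -[a b] /last_pairP [_ [aH _ bH _ f]]; apply/edgesP; split=> //;
    exact: HK.
move=> [a b] [c e] /last_pairP [baP [_ aD _ bD _]] /last_pairP [ecP [_ cD _ eD _]] ne.
rewrite disjoints_subset; apply/subsetP => s.
rewrite !inE negb_or => /orP[] /eqP -> /=; apply/andP; split; apply/eqP => eq.
- by move: baP ne; rewrite eq => /(dfs_snd spec2)/(_ ecP) ->; rewrite eqxx.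
- by move: aD; rewrite eq eD => /esym/n_Sn.
- by move: bD; rewrite eq cD => /n_Sn.
- by move: baP ne; rewrite eq => /(dfs_fst spec2)/(_ ecP) ->; rewrite eqxx.
Qed.

(** Contrary to the first interface, V-paths run away from the root, so a back-closed set has
    directly the form required by [dfs_acyclic]. *)
Lemma last_acyclic : acyclic MD.
Proof.
move=> X bX; have e0 : [set e in P | e.1 \in X] = set0.
  apply: (dfs_acyclic spec2); first by apply/subsetP => e /setIdP [].
  move=> [t a] /setIdP [taP /= tX]; have [s sX /leadP [c [ctM cs st']]] := bX t tX.
  have [tcP _] := last_pairP ctM; rewrite (dfs_fst spec2 taP tcP).
  have [_ _ /leadP [d [/last_pairP [sdP _] _ _]]] := bX s sX.
  exists (s, d); split=> //; first exact/setIdP.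
  by apply: contraNneq st' => -[->].
apply/setP => t; rewrite inE; apply/negP => tX.
have [s _ /leadP [c [/last_pairP [tcP _] _ _]]] := bX t tX.
by have := in_set0 (t, c); rewrite -e0 inE tcP tX.
Qed.

Lemma last_output : matching (edges K) (U :|: MD) /\ acyclic (U :|: MD).
Proof.
have MH : regular MD \subset H.
  apply/subsetP => s /regularP [[a b] /last_pairP [_ [aH _ bH _ _]]].
  by rewrite !inE => /orP[] /eqP ->.
have dis : [disjoint regular U & regular MD] by exact: disjointWr MH (st_disjoint st).
split; first exact: matchingU (st_matching st) last_matching dis.
apply: acyclicU (st_acyclic st) last_acyclic dis _ => a b c e /(st_tops st) bD.
case/last_pairP => _ [_ cD _ _ _]; apply/negP => /facet_card h.
by rewrite h cD ltnn in bD.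
Qed.

Lemma card_last : #|MD| = #|P|.
Proof. by rewrite card_imset // => -[a b] [c e] [-> ->]. Qed.

Lemma dual_adjacent_top x y : x \in simplices H D -> dual_adjacent x y ->
  y \in simplices H D.
Proof. by move=> _ /adjacentP [a []]. Qed.

(** A (D-1)-simplex not matched downwards is still in [H] by [st_level], hence an edge of the dual
    graph; [unmatched_facet_closed] takes care of the matched ones. *)
Lemma dual_component_closed r : r \in simplices H D ->
  facet_closed K D [set s | connect dual_adjacent r s].
Proof.
move=> rN; have BN s : connect dual_adjacent r s -> s \in simplices H D.
  exact: (invariant_connect dual_adjacent_top rN).
apply: (unmatched_facet_closed (st_acyclic st) (st_matching st)).
  by move=> s; rewrite inE => /BN /top_simplexP.
move=> s s' t; rewrite !inE => rs s'K s'D f f' no.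
have [<-//|ss'] := eqVneq s s'; apply: (connect_trans rs); apply: connect1.
have sN := BN s rs; have [sK sD] := top_simplexP sN.
have [tK tD _] := facet_top_simplex sK sD f.
apply/adjacentP; exists t; split=> //.
- by rewrite top_simplices; apply/simplicesP.
- apply/(lower_simplicesP (ltnW D_gt1)); split=> //; apply: contraT => tH.
  by have [a aU] := st_level st tK tD tH; have := no a; rewrite aU.
- by rewrite /joins ss' /= f.
Qed.

Lemma dual_component_sub r s : r \in simplices H D -> connect dual_adjacent r s ->
  s \in K /\ #|s| = D.+1.
Proof.
move=> rN rs; apply: top_simplexP.
exact: (invariant_connect dual_adjacent_top rN rs).
Qed.

(** All [D]-simplices around a vertex lie in one dual component, which contains a single root. *)
Lemma dual_roots_disjoint r r' v : r \in R2 -> r' \in R2 -> v \in r -> v \in r' -> r = r'.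
Proof.
move=> rR r'R vr vr'; apply: (dfs_separated spec2) => //.
have rN := subsetP (dfs_roots spec2) _ rR; have r'N := subsetP (dfs_roots spec2) _ r'R.
have [r'K r'D] := top_simplexP r'N; have [rK rD] := top_simplexP rN.
suff : r' \in [set s | connect dual_adjacent r s] by rewrite inE.
apply: (facet_closed_local manK (leqnn D) _ (dual_component_closed rN) (a :=
  [set v]) (s := r)).
- by move=> s; rewrite inE; exact: dual_component_sub.
- exact: (simplex_vertex manK rK).
- by rewrite sub1set.
- by rewrite inE connect0.
- by rewrite sub1set.
- exact: r'K.
- exact: r'D.
Qed.

(** Each dual component contains a [D]-simplex that [M] does not match. Otherwise the component
    would be back-closed: the facet matched with [s] has a second cofacet, again in the
    component. *)
Lemma dual_optimal M : morse_matching K M -> level M D + #|R2| <= #|simplices K D|.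
Proof.
move=> mor; have aM := morse_acyclic mor; have [mM _] := andP mor.
pose C := [set s in simplices K D | [forall a, (a, s) \notin M]].
have RC : #|R2| <= #|C|.
  apply: (separated_card (adjacent_sym _ _ _) (dfs_separated spec2)) => r rR.
  have rN := subsetP (dfs_roots spec2) _ rR.
  have [/existsP [s /andP[sC rs]]|no] := boolP [exists s, (s \in C) && connect
    dual_adjacent r s].
    by exists s.
  suff e0 : [set s | connect dual_adjacent r s] = set0.
    by have := in_set0 r; rewrite -e0 inE connect0.
  apply: aM => s; rewrite inE => rs; have [sK sD] := dual_component_sub rN rs.
  move: no; rewrite negb_exists => /forallP /(_ s); rewrite rs andbT inE negb_and.
  case/orP => [/negP[]|]; first by apply/simplicesP.
  rewrite negb_forall => /existsP [t]; rewrite negbK => tsM.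
  have f : facet t s by have /matchingP [/subsetP /(_ _ tsM) /edgesP []] := mM.
  have [_ tD c2] := facet_top_simplex sK sD f.
  have scof : s \in cofacets K t by rewrite mem_cofacets sK.
  have /set0Pn [s' /setD1P [ne]] : cofacets K t :\ s != set0.
    by rewrite -card_gt0; have := cardsD1 s (cofacets K t); rewrite c2 scof; case: #|_|.
  rewrite mem_cofacets => /andP[s'K f']; exists s'; last by apply/leadP; exists t.
  apply: (dual_component_closed rN _ s'K _ f f'); first by rewrite inE.
  by rewrite (facet_card f') tD.
apply: leq_trans (leq_add (leqnn _) RC) _.
have inj : {in [set e in M | #|e.2| == D.+1] &, injective snd}.
  move=> [a b] [c e] /setIdP [abM _] /setIdP [ceM _] /= be; subst e.
  by rewrite (matching_top mM abM ceM).
rewrite /level -(card_in_imset inj) -cardsUI.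
rewrite (_ : _ :&: C = set0) ?cards0 ?addn0.
  apply: subset_leq_card; apply/subsetP => s /setUP [|/setIdP [] //].
  case/imsetP => -[a b] /setIdP [abM /eqP /= bD] ->; apply/simplicesP; split=> //.
  by have /matchingP [/subsetP /(_ _ abM) /edgesP []] := mM.
apply/setP => s; rewrite !inE; apply/andP => -[/imsetP [[a b] /setIdP [abM _] /= ->]].
by case/andP => _ /forallP /(_ a); rewrite abM.
Qed.

End LastInterface.

(** Both sides count the incidences between (D-1)-simplices and [D]-simplices. *)
Lemma double_top_simplices : 2 * #|simplices K D.-1| = D.+1 * #|simplices K D|.
Proof.
have D0 := ltnW D_gt1.
transitivity (\sum_(t in simplices K D.-1) #|[set s in simplices K D | facet t s]|).
  rewrite mulnC -sum_nat_const; apply: eq_bigr => t /(lower_simplicesP D0) [tK tD].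
  rewrite -(manifold_codim1 manK tK tD); congr #|pred_of_set _|; apply/setP => s.
  rewrite !inE; have [f|] := boolP (facet t s); rewrite ?andbF // !andbT.
  by rewrite (facet_card f) tD eqxx andbT.
rewrite double_count mulnC -sum_nat_const; apply: eq_bigr => s /simplicesP [sK sD].
rewrite -sD -(card_facets s); congr #|pred_of_set _|; apply/setP => t; rewrite !inE.
have [f|] := boolP (facet t s); rewrite ?andbF // !andbT.
have [tK tD _] := facet_top_simplex sK sD f.
by rewrite tK tD prednK // eqxx.
Qed.

End Dual.

(** * The approximation ratio *)

Section Approximation.
Variables (R : realType) (V : finType) (K : {set {set V}}) (D : nat).
Hypothesis manK : simplicial_manifold R K D.
Implicit Types (s t a b c x y : {set V}) (v w : V) (B H : {set {set V}}).
Implicit Types (M U : {set {set V} * {set V}}).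

(** * Optimality of the search in the 1-interface, and its bound on disjoint [D]-simplices *)

Section FirstInterface.
Variables (M1 : {set {set V} * {set V}}) (R1 : {set {set V}}).
Hypothesis spec1 : dfs_spec (@facet V) (simplices K 0) (simplices K 1) M1 R1.

Notation vertex_adjacent := (adjacent (@facet V) (simplices K 0) (simplices K 1)).

(* In a component without a critical vertex every vertex v is matched with an
   edge, which leads to the edge matched with the other end of v. *)
Lemma first_optimal M : morse_matching K M -> level M 1 <= #|M1|.
Proof.
move=> mor; have aM := morse_acyclic mor; have [mM _] := andP mor.
have ME a b : (a, b) \in M -> [/\ a \in K, b \in K & facet a b].
  by move=> abM; apply/edgesP; have /matchingP [/subsetP /(_ _ abM)] := mM.
pose C := [set t in simplices K 0 | [forall b, (t, b) \notin M]].
have CP t : t \in simplices K 0 -> t \notin C -> exists b, (t, b) \in M.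
  move=> tN; rewrite inE tN /= negb_forall => /existsP [b]; rewrite negbK => tbM.
  by exists b.
have RC : #|R1| <= #|C|.
  apply: (separated_card (adjacent_sym _ _ _) (dfs_separated spec1)) => r rR.
  have rN := subsetP (dfs_roots spec1) _ rR.
  have [/existsP [t /andP[tC rt]]|no] := boolP [exists t, (t \in C) && connect
    vertex_adjacent r t].
    by exists t.
  have crit t : t \in simplices K 0 -> connect vertex_adjacent r t -> exists b, (t, b)
    \in M.
    move=> tN rt; apply: CP => //; move: no; rewrite negb_exists => /forallP /(_ t).
    by rewrite rt andbT.
  pose X := [set e.2 | e in M & connect vertex_adjacent r e.1 && (e.1 \in simplices K 0)].
  have X0 : X = set0.
    apply: (acyclic_forward aM) => s /imsetP [[a b]].
    rewrite inE => /and3P[abM /= ra /simplicesP [aK a1]] ->.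
    have [_ bK f] := ME a b abM; have b2 : #|b| = 2 by rewrite (facet_card f) a1.
    have [v aE vb] := facet_vertex f b2; have [w wb wv] := other_vertex v b2.
    have wN : [set w] \in simplices K 0.
      by apply/simplicesP; rewrite cards1 (simplex_vertex manK bK).
    have rw : connect vertex_adjacent r [set w].
      apply: (connect_trans ra); apply: connect1; rewrite aE.
      by apply: (edge_adjacent manK bK vb wb); rewrite eq_sym.
    have [c wcM] := crit _ wN rw.
    exists c; first by apply/imsetP; exists ([set w], c); rewrite // inE wcM rw.
    apply/leadP; exists [set w]; split=> //; first exact: vertex_facet.
    apply: contraNneq wv => bc; rewrite -bc in wcM.
    by have := matching_top mM abM wcM; rewrite aE => /set1_inj ->.
  have [b rbM] := crit r rN (connect0 _ _).
  have : b \in X by apply/imsetP; exists (r, b); rewrite // inE rbM connect0.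
  by rewrite X0 inE.
rewrite -(leq_add2l #|R1|) -(dfs_card spec1).
apply: leq_trans (leq_add RC (leqnn _)) _.
have inj : {in [set e in M | #|e.2| == 2] &, injective fst}.
  move=> [a b] [c e] /setIdP [abM _] /setIdP [ceM _] /= ac; subst c.
  by rewrite (matching_bottom mM abM ceM).
rewrite /level -(card_in_imset inj) -cardsUI.
rewrite (_ : C :&: _ = set0) ?cards0 ?addn0.
  apply: subset_leq_card; apply/subsetP => s /setUP [/setIdP [] //|].
  case/imsetP => -[a b] /setIdP [/ME [aK _ f] /eqP /= b2] ->; apply/simplicesP; split=> //.
  by apply/succn_inj; rewrite -(facet_card f).
apply/setP => s; rewrite !inE; apply/andP => -[/andP[_ /forallP no]].
by case/imsetP => -[a b] /setIdP [abM _] /= e; have := no b; rewrite e abM.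
Qed.

(* The roots of the dual search are disjoint D-simplices, and at most one vertex
   of each of them is a root of the first search. *)
Lemma disjoint_simplices_bound (N : {set {set V}}) :
    (forall s, s \in N -> s \in K /\ #|s| = D.+1) ->
    (forall s t v, s \in N -> t \in N -> v \in s -> v \in t -> s = t) ->
  D * #|N| <= #|M1|.
Proof.
move=> NK dis; pose A := [set v | [set v] \in simplices K 0 :\: R1].
have cA : #|A| <= #|M1|.
  rewrite -(leq_add2l #|R1|) -(dfs_card spec1) -(cardsID R1 (simplices K 0)).
  rewrite (setIidPr (dfs_roots spec1)) leq_add2l -(card_imset _ (@set1_inj V)).
  by apply: subset_leq_card; apply/subsetP => s /imsetP [v vA ->]; move: vA; rewrite in_set.
apply: leq_trans cA.
apply: (@leq_trans (\sum_(s in N) #|[set v in A | v \in s]|)).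
  rewrite mulnC -sum_nat_const; apply: leq_sum => s /NK [sK sD].
  have -> : [set v in A | v \in s] = s :\: [set v in s | [set v] \in R1].
    apply/setP => v; rewrite !inE; have [vs|] := boolP (v \in s); rewrite ?andbF //= andbT.
    by rewrite (simplex_vertex manK sK vs) cards1 /= andbT.
  have le1 : #|[set v in s | [set v] \in R1]| <= 1.
    apply/card_le1P => v /setIdP [vs vR] w; rewrite !inE; apply/andP/eqP => [[ws wR]|->//].
    exact: (first_root_unique manK spec1 sK).
  by rewrite cardsD (setIidPr _) ?subsetIl ?sD; [lia | apply/subsetP => v /setIdP []].
rewrite double_count -sum1_card; apply: leq_sum => v _.
apply/card_le1P => s /setIdP [sN vs] t; rewrite !inE; apply/andP/eqP => [[tN vt]|->//].
exact: dis vt vs.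
Qed.

End FirstInterface.

Lemma middle_interfaces_stage n H U H' U' : middle_interfaces D n H U H' U' ->
  1 < n -> stage K n H U -> stage K D H' U' /\ U \subset U'.
Proof.
elim=> {n H U H' U'} [//|n H U H1 U1 H' U' nD mid _ IH n1 st].
have [|st1 UU1] := stage_next manK _ st mid; first by rewrite n1.
by have [|st' UU'] := IH _ st1; [exact: ltnW | split=> //; exact: subset_trans UU'].
Qed.

Lemma middle_interfaces_exists n H U : 0 < n <= D ->
  exists H' U', middle_interfaces D n H U H' U'.
Proof.
move=> /andP[n0 nD]; have [k] := ubnP (D - n); elim: k => // k IH in n n0 nD H U *.
move=> le; have [->|ne] := eqVneq n D; first by exists H, U; constructor.
have lt : n < D by rewrite ltn_neqAle ne.
have [H1 [U1 mid]] := middle_interface_exists n0 H U.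
have [|H' [U' run]] := IH n.+1 (ltn0Sn n) lt H1 U1; first by lia.
by exists H', U'; exact: middle_interfaces_step lt mid run.
Qed.

Lemma min_facet_output_exists : 1 < D -> exists M, min_facet_output K D M.
Proof.
move=> D1.
have [M1 run1] := dfs_run_exists (@facet V) (simplices K 0) (simplices K 1) set0 [::] set0.
have [H [U mid]] := @middle_interfaces_exists 2 (delete_from K K 1 M1) M1 D1.
have [P run2] := dfs_run_exists [rel s t | facet t s] (simplices H D) (simplices H D.-1)
  set0 [::] set0.
exists (U :|: [set (x.2, x.1) | x in P]), M1, H, U, [set (x.2, x.1) | x in P].
by split=> //; exists P.
Qed.

Lemma min_facet_output_spec M : 2 < D -> min_facet_output K D M ->
  morse_matching K M /\ 2 * OPT K <= D * #|regular M|.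
Proof.
move=> D3 [M1 [H [U [MD [first mid [P run2 ->] ->]]]]].
have D1 : 1 < D by exact: ltnW.
have [R1 spec1] := first_interface_spec first.
have [//|st MU] := middle_interfaces_stage mid _ (first_stage manK spec1 (ltnW D1)).
have [R2 spec2] := dfs_optimal_spec (last_two_ends manK D1 st) run2.
have [mM aM] := last_output D1 st spec2.
split; first exact: acyclic_morse.
rewrite mul2n -geq_half_double; apply/bigmax_leqP => N mor; rewrite geq_half_double -mul2n.
have [mN _] := andP mor.
rewrite (card_regular mM) (card_regular mN) [D * _]mulnCA leq_mul2l /=.
have K0 : set0 \notin K by have /andP [] := manifold_complex manK.
have [NE _] := matchingP _ _ mN; have [UE _] := matchingP _ _ (st_matching st).
have cN := card_levels K0 NE (simplex_card manK);
  have cU := card_levels K0 UE (simplex_card manK).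
have cM1 : #|M1| <= level U 1 by rewrite -(first_level spec1); exact: level_mono.
have h := @approximation_arithmetic (level U) (level N) (fun i =>
  #|simplices K i|) D #|R2| #|P| #|simplices K D| D3.
rewrite cN; apply: leq_trans (h _ _ _ _ _ _ _) _.
- exact: st_count st.
- by move=> i i0; exact: level_adjacent.
- exact: leq_trans (first_optimal spec1 mor) cM1.
- exact: (dual_optimal manK D1 st spec2).
- by rewrite -(top_simplices st) (dfs_card spec2).
- exact: (double_top_simplices manK).
- apply: leq_trans cM1; apply: (disjoint_simplices_bound spec1).
    by move=> s /(subsetP (dfs_roots spec2)) /(top_simplexP st).
  by move=> s t v; exact: (dual_roots_disjoint manK D1 st spec2).
rewrite leq_mul2l; apply/orP; right.
(* The pairs of the last interface consist of simplices still in [H], which is disjoint from the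
   simplices matched before. *)
have -> : #|U :|: [set (x.2, x.1) | x in P]| = #|U| + #|P|.
  rewrite cardsU (card_last P) (_ : U :&: _ = set0) ?cards0 ?subn0 //.
  apply/setP => -[a b]; rewrite in_set0 in_setI; apply/andP => -[abU].
  by case/(last_pairP D1 spec2) => _ [_ _ bH _ _]; have := regular_snd abU;
    rewrite (disjointFl (st_disjoint st) bH).
by rewrite cU big_nat_recr ?(ltnW D1) //= addnAC leq_addr.
Qed.

End Approximation.

Import GRing.Theory Num.Theory.
Local Open Scope ring_scope.

Theorem theorem4p15 (R : realType) (V : finType) (K : {set {set V}}) (D : nat)
    (D_ge3 : (3 <= D)%N) (K_manifold : simplicial_manifold R K D) :
  (exists M, min_facet_output K D M) /\
  (forall M, min_facet_output K D M ->
     morse_matching K M /\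
     2%:R / D%:R * (OPT K)%:R <= #|regular M|%:R :> R).
Proof.
split; first by apply: min_facet_output_exists; exact: ltnW.
move=> M /(min_facet_output_spec K_manifold D_ge3) [morse ratio]; split=> //.
rewrite mulrAC ler_pdivrMr ?ltr0n ?(ltn_trans _ D_ge3) //.
by rewrite -!natrM ler_nat mulnC [(_ * D)%N]mulnC mulnC.
Qed.
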